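(* In the massive setting, let $p\in\mathcal P$ with $d_Qp=0$. Then $p$ is cohomologous (differs by some $d_Qb$, $b\in\mathcal P$) to a polynomial in the traceless variables $R^{(0)}_{\mu\nu;\rho\sigma;\lambda_1\dots\lambda_n}$, $\phi^{(0)}_{\mu\nu;\rho_1\dots\rho_n}$ and $\phi^{(0)}_{;\rho_1\dots\rho_n}$.
   Context: Minkowski metric $\eta=\mathrm{diag}(1,-1,-1,-1)$, mass $m>0$. $\mathcal P$ is the graded-commutative algebra of polynomials in the jet variables (modulo the Klein–Gordon equation $(d^\rho d_\rho+m^2)y=0$) of the fields $h_{\mu\nu}$ (symmetric, even), $v_\mu$ (even), $u_\mu,\tilde u_\mu$ (odd), with formal derivatives $d_\mu$. $d_Q$ is the graded derivation with $d_Qh_{\mu\nu}=-\frac i2(d_\mu u_\nu+d_\nu u_\mu-\eta_{\mu\nu}d_\rho u^\rho)$, $d_Qu_\mu=0$, $d_Q\tilde u_\mu=i(d^\nu h_{\mu\nu}+mv_\mu)$, $d_Qv_\mu=-\frac{im}{2}u_\mu$, $[d_Q,d_\mu]=0$. $h=\eta^{\mu\nu}h_{\mu\nu}$, $\hat h_{\mu\nu}=h_{\mu\nu}-\frac12\eta_{\mu\nu}h$, $\Gamma_{\mu;\nu\rho}=d_\rho\hat h_{\mu\nu}+d_\nu\hat h_{\mu\rho}-d_\mu\hat h_{\nu\rho}$, $R_{\mu\nu;\rho\sigma}=d_\rho\Gamma_{\mu;\nu\sigma}-d_\sigma\Gamma_{\mu;\nu\rho}$; $\phi_{\mu\nu}=d_\mu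 v_\nu+d_\nu v_\mu-\eta_{\mu\nu}d_\rho v^\rho-mh_{\mu\nu}$, $\phi=\eta^{\mu\nu}\phi_{\mu\nu}$. $R^{(0)}_{\mu\nu;\rho\sigma;\lambda_1\dots\lambda_n}$, $\phi^{(0)}_{\mu\nu;\rho_1\dots\rho_n}$, $\phi^{(0)}_{;\rho_1\dots\rho_n}$ denote the traceless parts of $d_{\lambda_1}\cdots d_{\lambda_n}R_{\mu\nu;\rho\sigma}$, $d_{\rho_1}\cdots d_{\rho_n}\phi_{\mu\nu}$, $d_{\rho_1}\cdots d_{\rho_n}\phi$ respectively. *)

(* Defs.v *)
(* Concrete model of the algebra P of the paper:
   the free graded-commutative C-algebra on the jet variables
   d^alpha y  (y a field component, alpha a multi-index in N^4),
   modulo the (differential) Klein-Gordon ideal and the symmetry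
   h_{mu nu} = h_{nu mu}.  Elements of P are represented by syntactic
   expressions [Expr C]; equality in P is the congruence [peq m]. *)
From HB Require Import structures.
From mathcomp Require Import all_boot all_order all_algebra.
Set Implicit Arguments. Unset Strict Implicit. Unset Printing Implicit Defensive.
Import Order.TTheory GRing.Theory Num.Theory.
Local Open Scope ring_scope.

Notation idx4 := 'I_4.

Inductive field :=
| Fh of idx4 & idx4
| Fv of idx4
| Fu of idx4
| Fut of idx4.

Definition odd_field (f : field) : bool :=
  match f with Fu _ | Fut _ => true | _ => false end.

(* multi-indices alpha in N^4 : the jet variable d_0^{a0}..d_3^{a3} y *)
Definition mindex := {ffun idx4 -> nat}.
Definition mi0 : mindex := [ffun => 0%N].
Definition mshift (a : mindex) (mu : idx4) : mindex :=
  [ffun j => (a j + (j == mu))%N].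

Definition jvar := (field * mindex)%type.

Section Algebra.
Variable C : numClosedFieldType.

Definition eta (mu nu : idx4) : C :=
  if mu == nu then (if mu == ord0 then 1 else -1) else 0.

Inductive Expr :=
| Const of C
| Var of jvar
| Add of Expr & Expr
| Mul of Expr & Expr.

Definition Sub (a b : Expr) := Add a (Mul (Const (-1)) b).
Definition Scal (c : C) (a : Expr) := Mul (Const c) a.

Definition esum (F : idx4 -> Expr) : Expr :=
  foldr (fun i acc => Add (F i) acc) (Const 0) (enum 'I_4).

Definition spatial : seq idx4 := [seq i <- enum 'I_4 | i != ord0].

(* equality in P: the congruence generated by the axioms of an associative
   unital graded-commutative C-algebra, the symmetry of h, and the
   Klein-Gordon relations (d^rho d_rho + m^2) d^alpha y = 0 for all jets. *)
Inductive peq (m : C) : Expr -> Expr -> Prop :=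
| peq_refl a : peq m a a
| peq_sym a b : peq m a b -> peq m b a
| peq_trans a b c : peq m a b -> peq m b c -> peq m a c
| peq_add a a' b b' : peq m a a' -> peq m b b' -> peq m (Add a b) (Add a' b')
| peq_mul a a' b b' : peq m a a' -> peq m b b' -> peq m (Mul a b) (Mul a' b')
| peq_addA a b c : peq m (Add a (Add b c)) (Add (Add a b) c)
| peq_addC a b : peq m (Add a b) (Add b a)
| peq_add0 a : peq m (Add (Const 0) a) a
| peq_addN a : peq m (Add a (Mul (Const (-1)) a)) (Const 0)
| peq_mulA a b c : peq m (Mul a (Mul b c)) (Mul (Mul a b) c)
| peq_mul1l a : peq m (Mul (Const 1) a) a
| peq_mul1r a : peq m (Mul a (Const 1)) a
| peq_mulDl a b c : peq m (Mul (Add a b) c) (Add (Mul a c) (Mul b c))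
| peq_mulDr a b c : peq m (Mul a (Add b c)) (Add (Mul a b) (Mul a c))
| peq_constD x y : peq m (Add (Const x) (Const y)) (Const (x + y))
| peq_constM x y : peq m (Mul (Const x) (Const y)) (Const (x * y))
| peq_constC x a : peq m (Mul (Const x) a) (Mul a (Const x))
| peq_varC (x y : jvar) :
    peq m (Mul (Var x) (Var y))
      (Mul (Const (if odd_field x.1 && odd_field y.1 then -1 else 1))
           (Mul (Var y) (Var x)))
| peq_odd_sq (x : jvar) : odd_field x.1 -> peq m (Mul (Var x) (Var x)) (Const 0)
| peq_hsym mu nu a : peq m (Var (Fh mu nu, a)) (Var (Fh nu mu, a))
| peq_KG (f : field) (a : mindex) :
    peq m (Var (f, mshift (mshift a ord0) ord0))
      (Add (foldr (fun i acc => Add (Var (f, mshift (mshift a i) i)) acc)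
                  (Const 0) spatial)
           (Mul (Const (- m ^+ 2)) (Var (f, a)))).

Fixpoint D (mu : idx4) (e : Expr) : Expr :=
  match e with
  | Const _ => Const 0
  | Var (f, a) => Var (f, mshift a mu)
  | Add a b => Add (D mu a) (D mu b)
  | Mul a b => Add (Mul (D mu a) b) (Mul a (D mu b))
  end.

Definition Dlist (s : seq idx4) (e : Expr) : Expr := foldr D e s.

Fixpoint sgn (e : Expr) : Expr :=
  match e with
  | Const c => Const c
  | Var x => if odd_field x.1 then Mul (Const (-1)) (Var x) else Var x
  | Add a b => Add (sgn a) (sgn b)
  | Mul a b => Mul (sgn a) (sgn b)
  end.

(* d_Q on jet variables: d^alpha applied to d_Q of the field *)
Definition dQvar (m : C) (x : jvar) : Expr :=
  let: (f, a) := x in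
  match f with
  | Fh mu nu =>
      Scal (- 'i / 2%:R)
        (Add (Add (Var (Fu nu, mshift a mu)) (Var (Fu mu, mshift a nu)))
             (Scal (- eta mu nu)
                (esum (fun r => Scal (eta r r) (Var (Fu r, mshift a r))))))
  | Fu _ => Const 0
  | Fut mu =>
      Scal 'i (Add (esum (fun nu => Scal (eta nu nu) (Var (Fh mu nu, mshift a nu))))
                   (Scal m (Var (Fv mu, a))))
  | Fv mu => Scal (- 'i * m / 2%:R) (Var (Fu mu, a))
  end.

Fixpoint dQ (m : C) (e : Expr) : Expr :=
  match e with
  | Const _ => Const 0
  | Var x => dQvar m x
  | Add a b => Add (dQ m a) (dQ m b)
  | Mul a b => Add (Mul (dQ m a) b) (Mul (sgn a) (dQ m b))
  end.

Definition hv (mu nu : idx4) := Var (Fh mu nu, mi0).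
Definition vv (mu : idx4) := Var (Fv mu, mi0).
Definition htr := esum (fun r => Scal (eta r r) (hv r r)).
Definition hhat mu nu := Sub (hv mu nu) (Scal (eta mu nu / 2%:R) htr).
Definition Gam mu nu rho :=
  Sub (Add (D rho (hhat mu nu)) (D nu (hhat mu rho))) (D mu (hhat nu rho)).
Definition Riem mu nu rho sig :=
  Sub (D rho (Gam mu nu sig)) (D sig (Gam mu nu rho)).
Definition phiT (m : C) mu nu :=
  Sub (Sub (Add (D mu (vv nu)) (D nu (vv mu)))
           (Scal (eta mu nu) (esum (fun r => Scal (eta r r) (D r (vv r))))))
      (Scal m (hv mu nu)).
Definition phitr (m : C) := esum (fun r => Scal (eta r r) (phiT m r r)).

Definition ix k (idx : 'I_k -> idx4) (j : nat) : idx4 :=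
  if insub j is Some o then idx o else ord0.

Definition set2 k (idx : 'I_k -> idx4) (a b : 'I_k) (r s : idx4) : 'I_k -> idx4 :=
  fun j => if j == a then r else if j == b then s else idx j.

Definition Rten n (idx : 'I_(4 + n) -> idx4) : Expr :=
  Dlist [seq ix idx (4 + j) | j <- iota 0 n]
        (Riem (ix idx 0) (ix idx 1) (ix idx 2) (ix idx 3)).
Definition Pten (m : C) n (idx : 'I_(2 + n) -> idx4) : Expr :=
  Dlist [seq ix idx (2 + j) | j <- iota 0 n] (phiT m (ix idx 0) (ix idx 1)).
Definition Pstr (m : C) n (idx : 'I_n -> idx4) : Expr :=
  Dlist [seq ix idx j | j <- iota 0 n] (phitr m).

(* S is the traceless part of T: S is traceless in every pair of indices
   (contraction with eta^{ab}), and T - S is a combination of terms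
   eta_{i_a i_b} U^{ab}(remaining indices). *)
Definition traceless_part (m : C) k (T S : ('I_k -> idx4) -> Expr) : Prop :=
  (forall (a b : 'I_k), (a < b)%N -> forall idx,
      peq m (esum (fun r => Scal (eta r r) (S (set2 idx a b r r)))) (Const 0)) /\
  exists U : 'I_k -> 'I_k -> ('I_k -> idx4) -> Expr,
    forall idx,
      peq m (Sub (T idx) (S idx))
        (foldr (fun (ab : 'I_k * 'I_k) acc =>
                  Add (Scal (eta (idx ab.1) (idx ab.2))
                            (U ab.1 ab.2 (set2 idx ab.1 ab.2 ord0 ord0))) acc)
               (Const 0)
               [seq ((a, b) : 'I_k * 'I_k) | a <- enum 'I_k,
                                 b <- [seq b : 'I_k <- enum 'I_k | (a < b)%N]]).

Inductive gen_alg (G : Expr -> Prop) : Expr -> Prop :=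
| ga_const c : gen_alg G (Const c)
| ga_gen e : G e -> gen_alg G e
| ga_add a b : gen_alg G a -> gen_alg G b -> gen_alg G (Add a b)
| ga_mul a b : gen_alg G a -> gen_alg G b -> gen_alg G (Mul a b).

End Algebra.

(* Main.v *)
Require Import Defs.
From HB Require Import structures.
From mathcomp Require Import all_boot all_order all_algebra.
From mathcomp Require Import boolp ring.
Import Order.TTheory GRing.Theory Num.Theory.
Import Defs.
Local Open Scope ring_scope.

(** The linear complex ut -> (h, v) -> u has a covariant contraction [homot]:
    u |-> (2i/m) v and
    h_{mu nu} |-> (i/m^2) (d_mu ut_nu + d_nu ut_mu - eta_{mu nu} d.ut).
    Extended to the whole algebra as an odd derivation, it gives the even
    derivation [weight] := [dq homot + homot dq], which is the identity on u, v
    and ut (this is where Klein-Gordon enters) and a projection on h.  Hence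
    every polynomial is a sum of eigenvectors of [weight] with eigenvalues in
    nat, a closed one is cohomologous to its component of eigenvalue 0, and the
    latter is a polynomial in the closed variables h - weight h, which equal
    - phi_{mu nu} / m up to exact terms.
      It remains to write the jets of phi, modulo exact terms, by traceless
    parts.  A tensor differs from its traceless part by a combination of its
    traces, and for d_{rho_1} ... d_{rho_n} phi_{mu nu} these are a jet of the
    scalar phi, exact terms (d^nu phi_{mu nu} = i m d_Q ut_mu) or, by
    Klein-Gordon, jets with n - 2 derivatives.  So one concludes by induction on
    n. *)

Set Implicit Arguments. Unset Strict Implicit. Unset Printing Implicit Defensive.

(** * The metric and traceless parts of tensors *)

Definition esign (C : numClosedFieldType) (r : idx4) : C := eta C r r.

Lemma etaE (C : numClosedFieldType) mu nu :
  eta C mu nu = if mu == nu then esign C mu else 0.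
Proof. by rewrite /esign /eta; case: (mu =P nu) => [->|]; rewrite ?eqxx. Qed.

Lemma esign_sq (C : numClosedFieldType) r : esign C r * esign C r = 1.
Proof.
by rewrite /esign /eta eqxx; case: ifP; rewrite ?mulr1 ?mulrNN ?mulr1.
Qed.

Lemma eta_sym (C : numClosedFieldType) mu nu : eta C mu nu = eta C nu mu.
Proof. by rewrite !etaE eq_sym; case: eqP => // ->. Qed.

Lemma eta_conj (C : numClosedFieldType) mu nu : (eta C mu nu)^* = eta C mu nu.
Proof.
rewrite /eta; case: ifP => _; [case: ifP => _|];
  by rewrite ?rmorphN ?rmorph1 ?rmorph0.
Qed.

(** * Orthogonal splitting for matrices fixed by conjugation *)

Section RealSplitting.
Variable C : numClosedFieldType.
Local Notation "A ^~" := (map_mx Num.conj A) (at level 2, format "A ^~").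

(** The diagonal entries of the product are the sums of squared norms over the columns of [W]. *)
Lemma mulmx_trC_eq0 p n (W : 'M[C]_(p, n)) : W^T *m W^~ = 0 -> W = 0.
Proof.
move=> h; apply/matrixP => i j; rewrite mxE.
have := congr1 (fun M : 'M_n => M j j) h; rewrite !mxE => /eqP.
rewrite psumr_eq0 => [/allP /(_ i)|l _]; rewrite !mxE -normCK ?exprn_ge0 //.
by rewrite mem_index_enum expf_eq0 normr_eq0 /= => /(_ isT) /eqP.
Qed.

(* Z realises the orthogonal projection A^T Z onto the row space of A. *)
Lemma real_mx_splitting p n (A : 'M[C]_(p, n)) : A^~ = A ->
  exists Z : 'M[C]_(p, n), A = A *m (A^T *m Z) /\ A^T *m Z = Z^T *m A.
Proof.
move=> Ar; have [M MA] : {M | M = A^T *m A} by exists (A^T *m A).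
have Mt : M^T = M by rewrite MA trmx_mul trmxK.
have Mr : M^~ = M by rewrite MA map_mxM -map_trmx Ar.
(* [M] is symmetric and fixed by conjugation, so if [X = D M] satisfies [X M = 0], then [X] times
   its conjugate transpose is [X M] times that of [D], hence zero. Therefore [M] and its square have
   the same row space. *)
have cap0 : (M :&: kermx M)%MS = 0.
  have /submxP[D eD] : ((M :&: kermx M)%MS <= M)%MS by apply: capmxSl.
  have /sub_kermxP h : ((M :&: kermx M)%MS <= kermx M)%MS by apply: capmxSr.
  apply: trmx_inj; rewrite trmx0; apply: mulmx_trC_eq0.
  rewrite trmxK -map_trmx [X in _ *m X^T](_ : _ = D^~ *m M).
    by rewrite trmx_mul Mt mulmxA h mul0mx.
  by rewrite eD map_mxM Mr.
have rkM : \rank (M *m M) = \rank M.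
  by have := mxrank_mul_ker M M; rewrite cap0 mxrank0 addn0.
have /submxP[D eD] : (M <= M *m M)%MS.
  by have [_ <-] := mxrank_leqif_sup (submxMl M M); rewrite rkM.
have eM : M = M *m M *m D^T.
  by have := congr1 trmx eD; rewrite Mt [in RHS]trmx_mul [(M *m M)^T]trmx_mul Mt.
(* From [M = D M M] and its transpose [M = M M D^T] one gets [M D^T = D M]. This symmetric matrix is
   the projection; that it fixes the rows of [A] is tested on the Gram matrix of the difference. *)
exists (A *m D^T); split.
  apply/eqP; rewrite -subr_eq0; apply/eqP; apply: mulmx_trC_eq0.
  rewrite !mulmxA -(mulmxA A) -MA.
  have -> : A - A *m M *m D^T = A *m (1%:M - M *m D^T).
    by rewrite mulmxBr mulmx1 mulmxA.
  rewrite map_mxM Ar trmx_mul -mulmxA (mulmxA A^T) -MA.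
  rewrite map_mxB map_mx1 map_mxM Mr mulmxBr mulmx1 mulmxA.
  have -> : M *m M *m D^T^~ = M by rewrite -[in LHS]Mr -!map_mxM -eM Mr.
  by rewrite subrr mulmx0.
rewrite trmx_mul trmxK mulmxA -MA -mulmxA -MA.
by rewrite [in RHS]eM {1}eD -!mulmxA.
Qed.

(** Put [u = Z T] and [S = T - A^T Z T]. The identity [A A^T Z = A] gives [A S = 0]. The symmetry
    [A^T Z = Z^T A] rewrites [T - S] as [Z^T (A T)], a combination of the contractions of [T]
    itself; this is the last clause. *)
Lemma real_splitting (I J : finType) (a : I -> J -> C) (V : lmodType C)
    (T : J -> V) : (forall i j, (a i j)^* = a i j) ->
  exists S u c, [/\ forall i, \sum_j a i j *: S j = 0,
    forall j, T j - S j = \sum_i a i j *: u i &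
    forall j, T j - S j = \sum_i c j i *: \sum_l a i l *: T l].
Proof.
move=> ar; pose A := \matrix_(i < #|I|, j < #|J|) a (enum_val i) (enum_val j).
have [|Z [Z1 Z2]] := @real_mx_splitting _ _ A.
  by apply/matrixP => i j; rewrite !mxE ar.
pose z i j := Z (enum_rank i) (enum_rank j).
have sumE (E : finType) (F : E -> C) :
    \sum_i F i = \sum_(i < #|E|) F (enum_val i).
  rewrite (reindex_onto enum_val enum_rank) => [|i _]; last exact: enum_rankK.
  by apply: eq_bigl => i; rewrite enum_valK eqxx.
(* [z1] and [z2] are the two matrix identities, read entrywise on the index types [I] and [J]. *)
have z1 i j : a i j = \sum_k a i k * \sum_i2 a i2 k * z i2 j.
  have := congr1 (fun M : 'M_(_, _) => M (enum_rank i) (enum_rank j)) Z1.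
  rewrite !mxE !enum_rankK => ->; rewrite [RHS]sumE; apply: eq_bigr => k _.
  rewrite !mxE enum_rankK [in RHS]sumE; congr (_ * _); apply: eq_bigr => l _.
  by rewrite !mxE /z enum_valK.
have z2 j k : \sum_i a i j * z i k = \sum_i z i j * a i k.
  have := congr1 (fun M : 'M_(_, _) => M (enum_rank j) (enum_rank k)) Z2.
  rewrite !mxE [LHS in _ -> LHS = _]sumE [RHS in _ -> _ = RHS]sumE => h.
  transitivity (\sum_i A^T (enum_rank j) i * Z i (enum_rank k)).
    by apply: eq_bigr => l _; rewrite !mxE /z enum_valK enum_rankK.
  rewrite h.
  by apply: eq_bigr => l _; rewrite !mxE /z enum_valK enum_rankK.
pose u i := \sum_l z i l *: T l.
exists (fun j => T j - \sum_i a i j *: u i), u, (fun j i => z i j).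
split=> [i|j|j]; last 2 first.
- by rewrite opprB addrC subrK.
- rewrite opprB addrC subrK.
  transitivity (\sum_l (\sum_i a i j * z i l) *: T l).
    under [RHS]eq_bigr do rewrite scaler_suml.
    rewrite exchange_big; apply: eq_bigr => i _; rewrite scaler_sumr.
    by apply: eq_bigr => l _; rewrite scalerA.
  under eq_bigr do rewrite z2 scaler_suml.
  rewrite exchange_big; apply: eq_bigr => i _; rewrite scaler_sumr.
  by apply: eq_bigr => l _; rewrite scalerA.
under eq_bigr do rewrite scalerBr; rewrite sumrB; apply/eqP; rewrite subr_eq0.
apply/eqP; under eq_bigr do rewrite z1 scaler_suml.
rewrite exchange_big; apply: eq_bigr => k _; rewrite scaler_sumr.
transitivity (\sum_l a i k *: ((\sum_i2 a i2 k * z i2 l) *: T l)).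
  by apply: eq_bigr => l _; rewrite scalerA.
rewrite -!scaler_sumr; congr (_ *: _).
under eq_bigr do rewrite scaler_suml.
rewrite exchange_big; apply: eq_bigr => i2 _; rewrite scaler_sumr.
by apply: eq_bigr => l _; rewrite scalerA.
Qed.
End RealSplitting.

(** * Traces of tensors as a real linear system *)

Section Traces.
Variables (C : numClosedFieldType) (k : nat) (V : lmodType C).
Local Notation e := (esign C).
Local Notation tens := {ffun 'I_k -> idx4}.

Definition reset (ab : 'I_k * 'I_k) (J : tens) : tens :=
  finfun (set2 J ab.1 ab.2 ord0 ord0).

(* The matrix of all the traces: row [((a, b), K)] contracts the indices a and b,
   the others being read off K, normalised by K a = K b = 0.  Its transpose
   maps U to the sum of the eta_{ab} U^{ab}. *)
Definition contr (i : ('I_k * 'I_k) * tens) (J : tens) : C :=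
  if (i.1.1 < i.1.2)%N && (reset i.1 J == i.2)
  then eta C (J i.1.1) (J i.1.2) else 0.

Lemma finfunK (idx : 'I_k -> idx4) : finfun idx = idx :> ('I_k -> idx4).
Proof. by apply: funext => j; rewrite ffunE. Qed.

Lemma set2_set2 (idx : 'I_k -> idx4) a b r s r' s' :
  set2 (set2 idx a b r s) a b r' s' = set2 idx a b r' s'.
Proof. by apply: funext => j; rewrite /set2; case: eqP => // ja; case: eqP. Qed.

(** A row with [K] not normalised at [a] and [b] vanishes. In any other row the surviving [J] agree
    with [K] off [a] and [b] and take one common value [r] there, which parametrises the sum. *)
Lemma sum_contr (T : ('I_k -> idx4) -> V) (a b : 'I_k) K : (a < b)%N ->
  \sum_(J : tens) contr ((a, b), K) J *: T J =
  if reset (a, b) K == K then \sum_r e r *: T (set2 K a b r r) else 0.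
Proof.
move=> ab; have ba : b != a by rewrite -val_eqE gtn_eqF.
have reset_id J : reset (a, b) (reset (a, b) J) = reset (a, b) J.
  by rewrite /reset /= finfunK set2_set2.
case: eqP => [rK|rK]; last first.
  apply: big1 => J _; rewrite /contr /= ab /=; case: eqP => [h|_]; last exact: scale0r.
  by case: rK; rewrite -h reset_id.
rewrite (bigID (fun J : tens => (reset (a, b) J == K) && (J a == J b))) /=.
rewrite [X in _ + X]big1 ?addr0; last first.
  move=> J; rewrite /contr /= ab /= etaE; case: eqP => //= _; rewrite ?scale0r //.
  by move=> /negbTE ->; rewrite scale0r.
rewrite (reindex_onto (fun r => finfun (set2 K a b r r)) (fun J : tens => J a)) /=.
  apply: eq_big => r.
    rewrite !ffunE /set2 eqxx (negbTE ba) !eqxx andbT.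
    by rewrite /reset /= finfunK set2_set2 -[X in _ == X]rK eqxx.
  move=> _; rewrite /contr /= ab /reset /= finfunK set2_set2 -/(reset (a, b) K).
  rewrite rK eqxx /=.
  by rewrite /set2 eqxx (negbTE ba) eqxx.
move=> J /andP[/eqP <- /eqP hab]; apply/ffunP => j.
rewrite ffunE /set2; case: eqP => [-> //|ja]; case: eqP => [-> //|jb].
by rewrite ffunE /set2; case: eqP => //; case: eqP.
Qed.

(** For each pair [ab] only the row [K = reset ab J] contributes. The pairs are listed in the order
    of [traceless_part]. *)
Lemma sum_contr_dual (u : ('I_k * 'I_k) * tens -> V) (J : tens) :
  \sum_i contr i J *: u i =
  \sum_(ab <- [seq ((a, b) : 'I_k * 'I_k) | a <- enum 'I_k,
                 b <- [seq b : 'I_k <- enum 'I_k | (a < b)%N]])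
     eta C (J ab.1) (J ab.2) *: u (ab, reset ab J).
Proof.
transitivity (\sum_a \sum_b \sum_K contr ((a, b), K) J *: u ((a, b), K)).
  rewrite pair_bigA pair_bigA /=.
  by apply: eq_bigr => -[[a b] K].
rewrite big_allpairs_dep big_enum; apply: eq_bigr => a _.
rewrite big_filter big_enum_cond [RHS]big_mkcond /=; apply: eq_bigr => b _.
rewrite /contr /=; case: ltnP => _ /=; last by apply: big1 => K _; rewrite scale0r.
rewrite (bigD1 (reset (a, b) J)) //= eqxx big1 ?addr0 // => K /negbTE h.
by rewrite eq_sym h scale0r.
Qed.

(* The clause on L says that T - S is a linear combination of traces of T. *)
Lemma traceless_exists (T : ('I_k -> idx4) -> V) :
  exists S : ('I_k -> idx4) -> V,
  [/\ forall a b : 'I_k, (a < b)%N -> forall idx,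
        \sum_r e r *: S (set2 idx a b r r) = 0,
      exists U : 'I_k -> 'I_k -> ('I_k -> idx4) -> V, forall idx,
        T idx - S idx =
        \sum_(ab <- [seq ((a, b) : 'I_k * 'I_k) | a <- enum 'I_k,
                 b <- [seq b : 'I_k <- enum 'I_k | (a < b)%N]])
          eta C (idx ab.1) (idx ab.2) *:
            U ab.1 ab.2 (set2 idx ab.1 ab.2 ord0 ord0) &
      forall L : V -> Prop, L 0 -> (forall x y, L x -> L y -> L (x + y)) ->
        (forall c x, L x -> L (c *: x)) ->
        (forall a b : 'I_k, (a < b)%N -> forall idx,
           L (\sum_r e r *: T (set2 idx a b r r))) ->
        forall idx, L (T idx - S idx)].
Proof.
have [|S [u [c [hS hU hL]]]] := @real_splitting C _ _ contr V (fun J : tens => T J).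
  by move=> i J; rewrite /contr; case: ifP => _; rewrite ?eta_conj ?rmorph0.
pose S' idx := S (finfun idx).
have S'E (J : tens) : S' J = S J by rewrite /S' ffunK.
have TSE idx : T idx - S' idx = T (finfun idx) - S (finfun idx).
  by rewrite finfunK.
exists S'; split.
- move=> a b ab idx; have := hS ((a, b), reset (a, b) (finfun idx)).
  under eq_bigr do rewrite -S'E.
  rewrite sum_contr // /reset /= !finfunK set2_set2 eqxx => h.
  by rewrite -[RHS]h; apply: eq_bigr => r _; rewrite set2_set2.
- exists (fun a b idx => u ((a, b), finfun idx)) => idx.
  rewrite TSE hU sum_contr_dual; apply: eq_bigr => -[a b] _.
  by rewrite /reset /= finfunK.
- move=> L L0 LD LZ hT idx; rewrite TSE hL.
  elim/big_ind: _ => // -[[a b] K] _; apply: LZ.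
  case: (ltnP a b) => ab; last first.
    rewrite big1 // => J _; rewrite /contr /= ltnNge ab /= scale0r //.
  by rewrite sum_contr //; case: ifP => // _; apply: hT.
Qed.
End Traces.

(** * The jet algebra as a quotient of expressions *)

Section ExprEq.
Variable C : numClosedFieldType.
HB.instance Definition _ := gen_eqMixin (Expr C).
HB.instance Definition _ := gen_choiceMixin (Expr C).
End ExprEq.

Section JetAlgebra.
Variables (C : numClosedFieldType) (m : C).
Local Notation e := (esign C).

(** The quotient is taken by a boolean relation, which classical logic extracts from the inductive
    [peq]. *)
Definition peqb (a b : Expr C) : bool := `[< peq m a b >].

Lemma peqb_refl : reflexive peqb.
Proof. by move=> a; apply/asboolP; apply: peq_refl. Qed.

Lemma peqb_sym : symmetric peqb.
Proof. by move=> a b; apply/asboolP/asboolP => h; apply: peq_sym. Qed.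

Lemma peqb_trans : transitive peqb.
Proof.
by move=> b a c /asboolP ab /asboolP bc; apply/asboolP; apply: peq_trans bc.
Qed.

Canonical peqb_equiv := EquivRel peqb peqb_refl peqb_sym peqb_trans.

Definition jets := {eq_quot peqb_equiv}%qT.
HB.instance Definition _ := Choice.on jets.

Definition cl (e : Expr C) : jets := (\pi_jets e)%qT.

Lemma clP (a b : Expr C) : cl a = cl b <-> peq m a b.
Proof.
split=> [/(@eqmodP _ peqb_equiv)/asboolP //|h].
by apply/(@eqmodP _ peqb_equiv)/asboolP.
Qed.

Definition rep (x : jets) : Expr C := repr x.

Lemma repK x : cl (rep x) = x.
Proof. exact: reprK. Qed.

Lemma peq_rep a : peq m (rep (cl a)) a.
Proof. by apply/clP; rewrite repK. Qed.

Definition jadd (x y : jets) := cl (Add (rep x) (rep y)).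
Definition jmul (x y : jets) := cl (Mul (rep x) (rep y)).
Definition jscale c (x : jets) := cl (Mul (Const c) (rep x)).

Lemma cl_jadd a b : cl (Add a b) = jadd (cl a) (cl b).
Proof. by apply/clP; apply: peq_add; apply: peq_sym; apply: peq_rep. Qed.
Lemma cl_jmul a b : cl (Mul a b) = jmul (cl a) (cl b).
Proof. by apply/clP; apply: peq_mul; apply: peq_sym; apply: peq_rep. Qed.
Lemma cl_jscale c a : cl (Mul (Const c) a) = jscale c (cl a).
Proof.
by apply/clP; apply: peq_mul; [exact: peq_refl | apply/peq_sym/peq_rep].
Qed.

Lemma jets_ind (P : jets -> Prop) : (forall a, P (cl a)) -> forall x, P x.
Proof. by move=> h x; rewrite -[x]repK. Qed.

Let jaddA : associative jadd.
Proof.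
elim/jets_ind=> a; elim/jets_ind=> b; elim/jets_ind=> c.
by rewrite -!cl_jadd; apply/clP; apply: peq_addA.
Qed.
Let jaddC : commutative jadd.
Proof.
elim/jets_ind=> a; elim/jets_ind=> b.
by rewrite -!cl_jadd; apply/clP; apply: peq_addC.
Qed.
Let jadd0 : left_id (cl (Const 0)) jadd.
Proof. by elim/jets_ind=> a; rewrite -!cl_jadd; apply/clP; apply: peq_add0. Qed.
Let jaddN : left_inverse (cl (Const 0)) (jscale (-1)) jadd.
Proof.
elim/jets_ind=> a; rewrite jaddC -cl_jscale -!cl_jadd; apply/clP.
exact: peq_addN.
Qed.

HB.instance Definition _ := GRing.isZmodule.Build jets jaddA jaddC jadd0 jaddN.

Let jmulA : associative jmul.
Proof.
elim/jets_ind=> a; elim/jets_ind=> b; elim/jets_ind=> c.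
by rewrite -!cl_jmul; apply/clP; apply: peq_mulA.
Qed.
Let jmul1l : left_id (cl (Const 1)) jmul.
Proof. by elim/jets_ind=> a; rewrite -!cl_jmul; apply/clP; apply: peq_mul1l. Qed.
Let jmul1r : right_id (cl (Const 1)) jmul.
Proof. by elim/jets_ind=> a; rewrite -!cl_jmul; apply/clP; apply: peq_mul1r. Qed.
Let jmulDl : left_distributive jmul jadd.
Proof.
elim/jets_ind=> a; elim/jets_ind=> b; elim/jets_ind=> c.
by rewrite -!(cl_jmul, cl_jadd); apply/clP; apply: peq_mulDl.
Qed.
Let jmulDr : right_distributive jmul jadd.
Proof.
elim/jets_ind=> a; elim/jets_ind=> b; elim/jets_ind=> c.
by rewrite -!(cl_jmul, cl_jadd); apply/clP; apply: peq_mulDr.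
Qed.

HB.instance Definition _ :=
  GRing.Zmodule_isPzRing.Build jets jmulA jmul1l jmul1r jmulDl jmulDr.

Lemma clD a b : cl (Add a b) = cl a + cl b. Proof. exact: cl_jadd. Qed.
Lemma clM a b : cl (Mul a b) = cl a * cl b. Proof. exact: cl_jmul. Qed.
Lemma cl0 : cl (Const 0) = 0. Proof. by []. Qed.
Lemma cl1 : cl (Const 1) = 1. Proof. by []. Qed.

Let jscaleE c x : jscale c x = cl (Const c) * x.
Proof. by elim/jets_ind: x => a; rewrite -cl_jscale clM. Qed.

Let jscaleA a b x : jscale a (jscale b x) = jscale (a * b) x.
Proof.
rewrite !jscaleE mulrA -clM; congr (_ * _); apply/clP; exact: peq_constM.
Qed.
Let jscale1 : left_id 1 jscale.
Proof. by move=> x; rewrite jscaleE cl1 mul1r. Qed.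
Let jscaleDr : right_distributive jscale +%R.
Proof. by move=> a x y; rewrite !jscaleE mulrDr. Qed.
Let jscaleDl x : {morph jscale^~ x : a b / a + b}.
Proof.
move=> a b; rewrite !jscaleE -mulrDl -clD; congr (_ * _).
by apply/clP/peq_sym/peq_constD.
Qed.

HB.instance Definition _ :=
  GRing.Zmodule_isLmodule.Build C jets jscaleA jscale1 jscaleDr jscaleDl.

Lemma scalejE c (x : jets) : c *: x = cl (Const c) * x.
Proof. exact: jscaleE. Qed.

Lemma clC c : cl (Const c) = c *: (1 : jets).
Proof. by rewrite scalejE mulr1. Qed.

Lemma clZ c a : cl (Scal c a) = c *: cl a.
Proof. by rewrite clM -scalejE. Qed.

Lemma scalej_mull c (x y : jets) : (c *: x) * y = c *: (x * y).
Proof. by rewrite !scalejE mulrA. Qed.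

Lemma scalej_mulr c (x y : jets) : x * (c *: y) = c *: (x * y).
Proof.
rewrite !scalejE !mulrA; congr (_ * _); elim/jets_ind: x => a.
by rewrite -!clM; apply/clP/peq_sym/peq_constC.
Qed.

Lemma clB a b : cl (Sub a b) = cl a - cl b.
Proof. by rewrite clD clM -scalejE scaleN1r. Qed.

Lemma cl_foldr (I : Type) (s : seq I) (F : I -> Expr C) :
  cl (foldr (fun i acc => Add (F i) acc) (Const 0) s) = \sum_(i <- s) cl (F i).
Proof.
elim: s => [|i s IHs]; first by rewrite big_nil.
by rewrite big_cons /= clD IHs.
Qed.

Lemma cl_esum (F : idx4 -> Expr C) : cl (esum F) = \sum_r cl (F r).
Proof. by rewrite cl_foldr big_enum. Qed.

Definition jet (f : field) (a : mindex) : jets := cl (Var C (f, a)).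
Lemma jet_hsym mu nu a : jet (Fh mu nu) a = jet (Fh nu mu) a.
Proof. by apply/clP; apply: peq_hsym. Qed.

(** [peq_KG] solves the Klein-Gordon equation for the second time derivative. This passes between
    that form and the covariant one, in which all later computations are made. *)
Lemma KG_sum (F : idx4 -> jets) x :
  (F ord0 = \sum_(i <- spatial) F i + x) <-> (\sum_r e r *: F r = x).
Proof.
have -> : \sum_r e r *: F r = F ord0 - \sum_(i <- spatial) F i.
  rewrite (bigD1 ord0) //= /esign /eta eqxx scale1r; congr (_ + _).
  rewrite /spatial big_filter -sumrN big_enum_cond /=.
  by apply: eq_bigr => i /negbTE ->; rewrite eqxx scaleN1r.
by split=> [->|<-]; rewrite ?(addrAC _ x) ?subrr ?add0r // addrC subrK.
Qed.

Lemma jet_KG f a : \sum_r e r *: jet f (mshift (mshift a r) r) = - m ^+ 2 *: jet f a.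
Proof.
apply/KG_sum; have /clP := peq_KG m f a.
by rewrite clD clM -scalejE cl_foldr.
Qed.

Lemma mshiftC a r s : mshift (mshift a r) s = mshift (mshift a s) r.
Proof. by apply/ffunP => j; rewrite !ffunE addnAC. Qed.

Lemma cl_varC (x y : jvar) : cl (Var C x) * cl (Var C y) =
  (if odd_field x.1 && odd_field y.1 then -1 else 1) *: (cl (Var C y) * cl (Var C x)).
Proof. by rewrite scalejE -!clM; apply/clP; apply: peq_varC. Qed.

(** Both sides of each axiom acquire the same sign when the odd variables are negated. *)
Lemma sgn_resp a b : peq m a b -> cl (sgn a) = cl (sgn b).
Proof.
elim=> {a b}.
- by [].
- by [].
- by move=> a b c _ -> _ ->.
- by move=> a a' b b' _ ha _ hb; rewrite /= !clD ha hb.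
- by move=> a a' b b' _ ha _ hb; rewrite /= !clM ha hb.
- by move=> a b c; rewrite /= !clD addrA.
- by move=> a b; rewrite /= !clD addrC.
- by move=> a; rewrite /= !clD cl0 add0r.
- by move=> a; rewrite /= !clD clM -scalejE scaleN1r subrr cl0.
- by move=> a b c; rewrite /= !clM mulrA.
- by move=> a; rewrite /= !clM cl1 mul1r.
- by move=> a; rewrite /= !clM cl1 mulr1.
- by move=> a b c; rewrite /= !(clM,clD) mulrDl.
- by move=> a b c; rewrite /= !(clM,clD) mulrDr.
- by move=> x y; rewrite /=; apply/clP/peq_constD.
- by move=> x y; rewrite /=; apply/clP/peq_constM.
- by move=> x a; rewrite /= !clM !clC scalej_mull scalej_mulr mul1r mulr1.
- move=> x y /=; have := cl_varC x y.
  case: (odd_field x.1); case: (odd_field y.1) => /= h; rewrite !clM !clC;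
  by rewrite ?(scalej_mull, mul1r, scalej_mulr, scale1r) h ?(scalerA, mulr1, scale1r).
- move=> x hx; rewrite /= hx !clM -!scalejE scalej_mull scalej_mulr -clM.
  by have /clP -> := peq_odd_sq m hx; rewrite cl0 !scaler0.
- by move=> mu nu a /=; apply: jet_hsym.
(* All jets of [f] carry the same sign [c], which factors out of the Klein-Gordon relation. *)
- move=> f a; pose c : C := if odd_field f then -1 else 1.
  have E b : cl (sgn (Var C (f, b))) = c *: jet f b.
    by rewrite /= /c; case: ifP; rewrite ?clM -?scalejE ?scale1r.
  rewrite E; have S s F :
      cl (sgn (foldr (fun i acc => Add (Var C (f, F i)) acc) (Const 0) s)) =
      \sum_(i <- s) c *: jet f (F i).
    elim: s => [|i s /= IH]; rewrite ?big_nil ?big_cons // clD IH.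
    by congr (_ + _); apply: E.
  rewrite [sgn _]/= clD S clM -scalejE E.
  apply/(KG_sum (fun i => c *: jet f (mshift (mshift a i) i))).
  rewrite scalerA mulrC -scalerA -jet_KG scaler_sumr.
  by apply: eq_bigr => r _; rewrite !scalerA mulrC.
Qed.

(** * Descent of derivations to the quotient *)

Definition lift (F : Expr C -> Expr C) (x : jets) : jets := cl (F (rep x)).

Lemma liftE F : (forall a b, peq m a b -> cl (F a) = cl (F b)) ->
  forall a, lift F (cl a) = cl (F a).
Proof. by move=> h a; apply: h; apply: peq_rep. Qed.

Definition sg := lift (@sgn C).
Lemma sgE a : sg (cl a) = cl (sgn a).
Proof. by apply: liftE => {a} a b; apply: sgn_resp. Qed.

Lemma sgD x y : sg (x + y) = sg x + sg y.
Proof.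
elim/jets_ind: x => a; elim/jets_ind: y => b.
by rewrite -clD !sgE /= clD.
Qed.
Lemma sgM x y : sg (x * y) = sg x * sg y.
Proof.
elim/jets_ind: x => a; elim/jets_ind: y => b.
by rewrite -clM !sgE /= clM.
Qed.
Lemma sgC c : sg (cl (Const c)) = cl (Const c).
Proof. by rewrite sgE. Qed.
Lemma sg_is_linear : linear sg.
Proof. by move=> c x y; rewrite sgD scalejE sgM sgC -scalejE. Qed.
HB.instance Definition _ := GRing.isLinear.Build C jets jets *:%R sg sg_is_linear.
Lemma sg_jet f a : sg (jet f a) = (if odd_field f then -1 else 1) *: jet f a.
Proof. by rewrite sgE /=; case: ifP; rewrite ?clM -?scalejE ?scale1r. Qed.
Lemma sgK x : sg (sg x) = x.
Proof.
elim/jets_ind: x => a; rewrite !sgE; elim: a => //=.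
- move=> x; case hx: (odd_field _); rewrite /= ?hx ?clM //= ?clM.
  by rewrite -!scalejE scalerA mulrNN mulr1 scale1r.
- by move=> a ha b hb; rewrite !clD ha hb.
- by move=> a ha b hb; rewrite !clM ha hb.
Qed.

(* For the derivations D (T = id) and the antiderivations d_Q and homot (T = sg). *)
Lemma der_resp (T : jets -> jets) (F : Expr C -> jets)
  (TD : {morph T : x y / x + y}) (TM : {morph T : x y / x * y})
  (TC : forall c, T (cl (Const c)) = cl (Const c))
  (FC : forall c, F (Const c) = 0)
  (FD : forall a b, F (Add a b) = F a + F b)
  (FM : forall a b, F (Mul a b) = F a * cl b + T (cl a) * F b)
  (Fvar : forall x y : jvar, let vx := Var C x in let vy := Var C y in
     F vx * cl vy + T (cl vx) * F vy =
     (if odd_field x.1 && odd_field y.1 then -1 else 1) *: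
       (F vy * cl vx + T (cl vy) * F vx))
  (Fodd : forall x : jvar, odd_field x.1 ->
     F (Var C x) * cl (Var C x) + T (cl (Var C x)) * F (Var C x) = 0)
  (Fh_sym : forall mu nu a, F (Var C (Fh mu nu, a)) = F (Var C (Fh nu mu, a)))
  (FKG : forall f a, \sum_r e r *: F (Var C (f, mshift (mshift a r) r)) =
     - m ^+ 2 *: F (Var C (f, a))) a b :
  peq m a b -> F a = F b.
Proof.
have FZ c x : F (Mul (Const c) x) = c *: F x.
  by rewrite FM FC mul0r add0r TC scalejE.
elim=> {a b}.
- by [].
- by [].
- by move=> a b c _ -> _ ->.
- by move=> a a' b b' _ ha _ hb; rewrite !FD ha hb.
- by move=> a a' b b' /clP ea ha /clP eb hb; rewrite !FM ha hb ea eb.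
- by move=> a b c; rewrite !FD addrA.
- by move=> a b; rewrite !FD addrC.
- by move=> a; rewrite !FD FC add0r.
- by move=> a; rewrite !FD FZ scaleN1r subrr FC.
- by move=> a b c; rewrite !FM !clM TM mulrDl mulrDr !mulrA addrA.
- by move=> a; rewrite FZ scale1r.
- by move=> a; rewrite FM FC cl1 mulr1 mulr0 addr0.
- by move=> a b c; rewrite !(FM,FD,clD,TD) !mulrDl addrACA.
- by move=> a b c; rewrite !(FM,FD,clD,TD) !mulrDr addrACA.
- by move=> x y; rewrite FD !FC addr0.
- by move=> x y; rewrite FZ !FC scaler0.
- move=> x a; rewrite !FM !FC TC clC mulr0 mul0r add0r addr0.
  by rewrite scalej_mull scalej_mulr mulr1 mul1r.
- by move=> x y; rewrite FZ !FM Fvar.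
- by move=> x hx; rewrite FM FC; apply: Fodd.
- exact: Fh_sym.
- move=> f a.
  have S s G :
      F (foldr (fun i acc => Add (Var C (f, G i)) acc) (Const 0) s) =
      \sum_(i <- s) F (Var C (f, G i)).
    by elim: s => [|i s IH] /=; rewrite ?big_nil ?FC ?big_cons // FD IH.
  rewrite FD S FZ.
  by apply/(KG_sum (fun i => F (Var C (f, mshift (mshift a i) i)))); apply: FKG.
Qed.


(** Homogeneity of parity [b], expressed by the two consequences used below, so that no grading of
    the quotient has to be constructed. *)
Definition par (b : bool) (x : jets) : Prop :=
  sg x = (-1) ^+ b *: x /\
  forall y : jvar, x * cl (Var C y) =
    (-1) ^+ (b && odd_field y.1) *: (cl (Var C y) * x).

Lemma par_jet f a : par (odd_field f) (jet f a).
Proof.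
split=> [|y]; first by rewrite sg_jet; case: odd_field.
by rewrite cl_varC /=; case: (_ && _).
Qed.

Lemma par0 b : par b 0.
Proof. by split=> [|y]; rewrite ?linear0 ?mul0r ?mulr0 ?scaler0. Qed.

Lemma parD b x y : par b x -> par b y -> par b (x + y).
Proof.
move=> [sx cx] [sy cy]; split=> [|z]; first by rewrite sgD sx sy scalerDr.
by rewrite mulrDl cx cy mulrDr scalerDr.
Qed.

Lemma parZ b c x : par b x -> par b (c *: x).
Proof.
move=> [sx cx]; split=> [|z]; first by rewrite linearZ /= sx !scalerA mulrC.
by rewrite scalej_mull scalej_mulr cx !scalerA mulrC.
Qed.

Lemma par_sum b (F : idx4 -> jets) :
  (forall r, par b (F r)) -> par b (\sum_r F r).
Proof. by move=> h; elim/big_ind: _ => //; [exact: par0 | exact: parD]. Qed.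

(** Such families are stable under shifts and linear combinations, so values on the generators that
    are linear in the jets respect Klein-Gordon automatically. *)
Definition KGsol (F : mindex -> jets) : Prop :=
  forall a, \sum_r e r *: F (mshift (mshift a r) r) = - m ^+ 2 *: F a.

Lemma KGsol_jet f : KGsol (jet f).
Proof. exact: jet_KG. Qed.

Lemma KGsol_shift F mu : KGsol F -> KGsol (fun a => F (mshift a mu)).
Proof.
by move=> h a; rewrite -h; apply: eq_bigr => r _; rewrite !(mshiftC _ mu).
Qed.

Lemma KGsol0 : KGsol (fun=> 0).
Proof. by move=> a; rewrite scaler0 big1 // => r; rewrite scaler0. Qed.

Lemma KGsolD F G : KGsol F -> KGsol G -> KGsol (fun a => F a + G a).
Proof.
move=> hF hG a; rewrite scalerDr -hF -hG -big_split.
by apply: eq_bigr => r _; rewrite scalerDr.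
Qed.

Lemma KGsolZ c F : KGsol F -> KGsol (fun a => c *: F a).
Proof.
move=> hF a; rewrite scalerA mulrC -scalerA -hF scaler_sumr.
by apply: eq_bigr => r _; rewrite !scalerA mulrC.
Qed.

Lemma KGsol_sum (F : idx4 -> mindex -> jets) :
  (forall s, KGsol (F s)) -> KGsol (fun a => \sum_s F s a).
Proof.
move=> hF a; rewrite scaler_sumr.
under eq_bigr do rewrite scaler_sumr.
by rewrite exchange_big; apply: eq_bigr => s _; apply: hF.
Qed.

(** Descent is checked on the variables only. Since [F] reverses parity, the Koszul signs match in
    the exchange relation; for an odd variable [x], the value [F x] commutes with [x], while
    [sg x = - x], so the two Leibniz terms of its square cancel. *)
Lemma odd_der_resp (F : Expr C -> Expr C)
  (FC : forall c, F (Const c) = Const 0)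
  (FD : forall a b, F (Add a b) = Add (F a) (F b))
  (FM : forall a b, F (Mul a b) = Add (Mul (F a) b) (Mul (sgn a) (F b)))
  (Fpar : forall f a, par (~~ odd_field f) (cl (F (Var C (f, a)))))
  (Fh_sym : forall mu nu a,
     cl (F (Var C (Fh mu nu, a))) = cl (F (Var C (Fh nu mu, a))))
  (FKG : forall f, KGsol (fun a => cl (F (Var C (f, a))))) a b :
  peq m a b -> cl (F a) = cl (F b).
Proof.
apply: (der_resp (T := sg) (F := fun x => cl (F x))) => {a b} //.
- exact: sgD.
- exact: sgM.
- exact: sgC.
- by move=> c; rewrite FC.
- by move=> a b; rewrite FD clD.
- by move=> a b; rewrite FM clD !clM sgE.
- move=> [f a] [g b] /=; rewrite (Fpar f a).2 (Fpar g b).2 /=.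
  rewrite -!/(jet _ _) !sg_jet !scalej_mull.
  case: (odd_field f); case: (odd_field g);
    rewrite /= ?expr0 ?expr1 ?scale1r ?scaleN1r // ?opprD ?opprK addrC //.
- move=> [f a] /= h; rewrite (Fpar f a).2 /= -/(jet _ _) sg_jet h /=.
  by rewrite expr0 scale1r scalej_mull scaleN1r subrr.
Qed.

(* Common shape of d_Q h (F = u), homot h (F = ut) and phi + m h (F = v). *)
Definition grad (F : idx4 -> field) mu nu (a : mindex) : jets :=
  jet (F nu) (mshift a mu) + jet (F mu) (mshift a nu)
  - eta C mu nu *: \sum_r e r *: jet (F r) (mshift a r).

Lemma gradC F mu nu a : grad F mu nu a = grad F nu mu a.
Proof. by rewrite /grad eta_sym [X in X - _]addrC. Qed.

Lemma KGsol_grad F mu nu : KGsol (grad F mu nu).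
Proof.
have h f r := KGsol_shift r (KGsol_jet f).
rewrite /grad => a; rewrite -scaleNr.
rewrite -(KGsolD (KGsolD (h _ mu) (h _ nu))
  (KGsolZ _ (KGsol_sum (fun s => KGsolZ _ (h _ s))))).
by under [RHS]eq_bigr do rewrite scaleNr.
Qed.

Lemma par_grad F b mu nu a :
  (forall r, odd_field (F r) = b) -> par b (grad F mu nu a).
Proof.
move=> h; have hY r c : par b (jet (F r) c) by rewrite -(h r); apply: par_jet.
rewrite /grad -scaleNr; apply: parD; first exact: parD.
by apply/parZ/par_sum => r; apply: parZ.
Qed.

Lemma eta_sum mu (X : idx4 -> jets) :
  \sum_nu e nu *: (eta C mu nu *: X nu) = X mu.
Proof.
rewrite (bigD1 mu) //= scalerA [eta _ _ _](etaE) eqxx esign_sq scale1r.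
by rewrite big1 ?addr0 // => r /negbTE h; rewrite etaE eq_sym h scale0r scaler0.
Qed.

(** The eta term cancels the mixed derivative [d_mu d^nu F_nu]; what remains is the wave operator on
    [F_mu], evaluated by Klein-Gordon. *)
Lemma div_grad F mu a :
  \sum_nu e nu *: grad F mu nu (mshift a nu) = - m ^+ 2 *: jet (F mu) a.
Proof.
rewrite /grad; under eq_bigr do rewrite scalerBr scalerDr.
rewrite sumrB big_split /= jet_KG.
rewrite (eta_sum mu (fun nu => \sum_r e r *: jet (F r) (mshift (mshift a nu) r))).
by under eq_bigr do rewrite mshiftC; rewrite addrAC subrr add0r.
Qed.

Definition div_h mu a : jets := \sum_nu e nu *: jet (Fh mu nu) (mshift a nu).

Lemma KGsol_div_h mu : KGsol (div_h mu).
Proof. exact: KGsol_sum (fun s => KGsolZ _ (KGsol_shift _ (KGsol_jet _))). Qed.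

Lemma dQvar_h mu nu a :
  cl (dQvar m (Fh mu nu, a)) = (- 'i / 2%:R) *: grad Fu mu nu a.
Proof.
rewrite clZ !clD clZ cl_esum scaleNr; congr (_ *: (_ - _ *: _)).
by apply: eq_bigr => r _; rewrite clZ.
Qed.

Lemma dQvar_ut mu a :
  cl (dQvar m (Fut mu, a)) = 'i *: (div_h mu a + m *: jet (Fv mu) a).
Proof.
rewrite clZ !clD clZ cl_esum; congr (_ *: (_ + _)).
by apply: eq_bigr => r _; rewrite clZ.
Qed.

Lemma dQvar_v mu a :
  cl (dQvar m (Fv mu, a)) = (- 'i * m / 2%:R) *: jet (Fu mu) a.
Proof. exact: clZ. Qed.

Lemma par_dQvar f a : par (~~ odd_field f) (cl (dQvar m (f, a))).
Proof.
case: f => [mu nu|mu|mu|mu].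
- by rewrite dQvar_h; apply/parZ/par_grad.
- by rewrite dQvar_v; apply/parZ/(par_jet (Fu mu)).
- by rewrite cl0; apply: par0.
- rewrite dQvar_ut; apply/parZ/parD; last exact/parZ/(par_jet (Fv mu)).
  by apply: par_sum => r; apply/parZ/(par_jet (Fh mu r)).
Qed.

Lemma dQ_resp a b : peq m a b -> cl (dQ m a) = cl (dQ m b).
Proof.
apply: odd_der_resp => {a b} //.
- exact: par_dQvar.
- by move=> mu nu a; rewrite ![dQ _ _]/= !dQvar_h gradC.
- case=> [mu nu|mu|mu|mu] a; rewrite [dQ _ _]/=.
  + under eq_bigr do rewrite [dQ _ _]/= dQvar_h.
    rewrite dQvar_h; exact: (KGsolZ _ (KGsol_grad _ _ _)).
  + under eq_bigr do rewrite [dQ _ _]/= dQvar_v.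
    rewrite dQvar_v; exact: (KGsolZ _ (KGsol_jet _)).
  + under eq_bigr do rewrite [dQ _ _]/= cl0.
    rewrite cl0; exact: KGsol0.
  + under eq_bigr do rewrite [dQ _ _]/= dQvar_ut.
    rewrite dQvar_ut.
    exact: (KGsolZ _ (KGsolD (KGsol_div_h _) (KGsolZ _ (KGsol_jet _)))).
Qed.

(** * The contracting homotopy *)

(** The constants are chosen to make [weight] the identity: on [u], [(2i/m) (- i m / 2) = 1]; on
    [ut], [i] times [- i / m^2 * m^2] is 1, the factor [- m^2] coming from [div_grad]. *)
Definition homot_var (x : jvar) : Expr C :=
  let: (f, a) := x in
  match f with
  | Fh mu nu =>
      Scal ('i / m ^+ 2)
        (Add (Add (Var C (Fut nu, mshift a mu)) (Var C (Fut mu, mshift a nu)))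
           (Scal (- eta C mu nu)
              (esum (fun r => Scal (eta C r r) (Var C (Fut r, mshift a r))))))
  | Fu mu => Scal (2%:R * 'i / m) (Var C (Fv mu, a))
  | _ => Const 0
  end.

Fixpoint homot_expr (e : Expr C) : Expr C :=
  match e with
  | Const _ => Const 0
  | Var x => homot_var x
  | Add a b => Add (homot_expr a) (homot_expr b)
  | Mul a b => Add (Mul (homot_expr a) b) (Mul (sgn a) (homot_expr b))
  end.

Lemma homot_var_h mu nu a :
  cl (homot_var (Fh mu nu, a)) = ('i / m ^+ 2) *: grad Fut mu nu a.
Proof.
rewrite clZ !clD clZ cl_esum scaleNr; congr (_ *: (_ - _ *: _)).
by apply: eq_bigr => r _; rewrite clZ.
Qed.

Lemma homot_var_u mu a : cl (homot_var (Fu mu, a)) = (2%:R * 'i / m) *: jet (Fv mu) a.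
Proof. exact: clZ. Qed.

Lemma par_homot_var f a : par (~~ odd_field f) (cl (homot_var (f, a))).
Proof.
case: f => [mu nu|mu|mu|mu]; rewrite ?cl0; try exact: par0.
- by rewrite homot_var_h; apply/parZ/par_grad.
- by rewrite homot_var_u; apply/parZ/(par_jet (Fv mu)).
Qed.

Lemma homot_expr_resp a b : peq m a b -> cl (homot_expr a) = cl (homot_expr b).
Proof.
apply: odd_der_resp => {a b} //.
- exact: par_homot_var.
- by move=> mu nu a; rewrite ![homot_expr _]/= !homot_var_h gradC.
- case=> [mu nu|mu|mu|mu] a; rewrite [homot_expr _]/=; try exact: KGsol0.
  + under eq_bigr do rewrite [homot_expr _]/= homot_var_h.
    rewrite homot_var_h; exact: (KGsolZ _ (KGsol_grad _ _ _)).
  + under eq_bigr do rewrite [homot_expr _]/= homot_var_u.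
    rewrite homot_var_u; exact: (KGsolZ _ (KGsol_jet _)).
Qed.

Lemma D_resp mu a b : peq m a b -> cl (D mu a) = cl (D mu b).
Proof.
apply: (der_resp (T := id) (F := fun x => cl (D mu x))) => {a b} //.
- by move=> a b /=; rewrite clD.
- by move=> a b /=; rewrite clD !clM.
- move=> [f a] [g b] /=; rewrite cl_varC (cl_varC (f, _)) /=.
  by rewrite addrC scalerDr.
- move=> [f a] /= h; rewrite cl_varC /= h scaleN1r addNr //.
- by move=> nu rho a; apply: jet_hsym.
- by move=> f a; apply: (KGsol_shift mu (KGsol_jet f)).
Qed.

Definition dq := lift (dQ m).
Definition homot := lift homot_expr.
Definition Dj mu := lift (D mu).

Lemma dqE a : dq (cl a) = cl (dQ m a).
Proof. by apply: liftE => {a} a b; apply: dQ_resp. Qed.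
Lemma homotE a : homot (cl a) = cl (homot_expr a).
Proof. by apply: liftE => {a} a b; apply: homot_expr_resp. Qed.
Lemma DjE mu a : Dj mu (cl a) = cl (D mu a).
Proof. by apply: liftE => {a} a b; apply: D_resp. Qed.

Lemma dqM x y : dq (x * y) = dq x * y + sg x * dq y.
Proof.
elim/jets_ind: x => a; elim/jets_ind: y => b.
by rewrite -clM !dqE sgE -!clM -clD.
Qed.
Lemma homotM x y : homot (x * y) = homot x * y + sg x * homot y.
Proof.
elim/jets_ind: x => a; elim/jets_ind: y => b.
by rewrite -clM !homotE sgE -!clM -clD.
Qed.

Lemma dq_is_linear : linear dq.
Proof.
move=> c; elim/jets_ind=> a; elim/jets_ind=> b.
rewrite -clZ -clD !dqE /= !(clD, clM) cl0 mul0r add0r.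
by rewrite -scalejE.
Qed.
HB.instance Definition _ := GRing.isLinear.Build C jets jets *:%R dq dq_is_linear.
Lemma homot_is_linear : linear homot.
Proof.
move=> c; elim/jets_ind=> a; elim/jets_ind=> b.
rewrite -clZ -clD !homotE /= !(clD, clM) cl0 mul0r add0r.
by rewrite -scalejE.
Qed.
HB.instance Definition _ := GRing.isLinear.Build C jets jets *:%R homot homot_is_linear.
Lemma Dj_is_linear mu : linear (Dj mu).
Proof.
move=> c; elim/jets_ind=> a; elim/jets_ind=> b.
rewrite -clZ -clD !DjE /= !(clD, clM) cl0 mul0r add0r.
by rewrite -scalejE.
Qed.
HB.instance Definition _ mu :=
  GRing.isLinear.Build C jets jets *:%R (Dj mu) (Dj_is_linear mu).

Lemma dq_h mu nu a : dq (jet (Fh mu nu) a) = (- 'i / 2%:R) *: grad Fu mu nu a.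
Proof. by rewrite dqE dQvar_h. Qed.
Lemma dq_ut mu a : dq (jet (Fut mu) a) = 'i *: (div_h mu a + m *: jet (Fv mu) a).
Proof. by rewrite dqE dQvar_ut. Qed.
Lemma dq_v mu a : dq (jet (Fv mu) a) = (- 'i * m / 2%:R) *: jet (Fu mu) a.
Proof. by rewrite dqE dQvar_v. Qed.
Lemma dq_u mu a : dq (jet (Fu mu) a) = 0.
Proof. by rewrite dqE. Qed.
Lemma homot_h mu nu a : homot (jet (Fh mu nu) a) = ('i / m ^+ 2) *: grad Fut mu nu a.
Proof. by rewrite homotE homot_var_h. Qed.
Lemma homot_ut mu a : homot (jet (Fut mu) a) = 0.
Proof. by rewrite homotE. Qed.
Lemma homot_v mu a : homot (jet (Fv mu) a) = 0.
Proof. by rewrite homotE. Qed.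
Lemma homot_u mu a : homot (jet (Fu mu) a) = (2%:R * 'i / m) *: jet (Fv mu) a.
Proof. by rewrite homotE homot_var_u. Qed.
Lemma Dj_jet mu f a : Dj mu (jet f a) = jet f (mshift a mu).
Proof. by rewrite DjE. Qed.

Lemma dq1 : dq 1 = 0. Proof. by rewrite -cl1 dqE. Qed.
Lemma homot1 : homot 1 = 0. Proof. by rewrite -cl1 homotE. Qed.
Lemma sg1 : sg 1 = 1. Proof. by rewrite -cl1 sgE. Qed.

Lemma sgZ c x : sg (c *: x) = c *: sg x. Proof. exact: linearZ_LR. Qed.
Lemma dqZ c x : dq (c *: x) = c *: dq x. Proof. exact: linearZ_LR. Qed.
Lemma homotZ c x : homot (c *: x) = c *: homot x. Proof. exact: linearZ_LR. Qed.
Lemma dqD x y : dq (x + y) = dq x + dq y. Proof. exact: linearD. Qed.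
Lemma homotD x y : homot (x + y) = homot x + homot y. Proof. exact: linearD. Qed.
Lemma dq0 : dq 0 = 0. Proof. exact: linear0. Qed.
Lemma homot0 : homot 0 = 0. Proof. exact: linear0. Qed.
Lemma sg0 : sg 0 = 0. Proof. exact: linear0. Qed.

Lemma jets_poly_ind (P : jets -> Prop) :
  (forall c, P (c *: (1 : jets))) -> (forall f a, P (jet f a)) ->
  (forall x y, P x -> P y -> P (x + y)) -> (forall x y, P x -> P y -> P (x * y)) ->
  forall x, P x.
Proof.
move=> hC hY hD hM; elim/jets_ind; elim=> [c|[f a]|a ha b hb|a ha b hb].
- by rewrite clC.
- exact: hY.
- by rewrite clD; apply: hD.
- by rewrite clM; apply: hM.
Qed.

Lemma sg_dq x : sg (dq x) = - dq (sg x).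
Proof.
elim/jets_poly_ind: x => [c|f a|x y hx hy|x y hx hy].
- by rewrite dqZ !sgZ dqZ sg1 dq1 sg0 !scaler0 oppr0.
- rewrite sg_jet dqZ dqE (par_dQvar f a).1.
  by case: odd_field; rewrite /= ?expr1 ?expr0 ?scaleN1r ?scale1r ?opprK.
- by rewrite ?(dqD, homotD, sgD) hx hy opprD.
- by rewrite dqM !sgM dqM sgD !sgM hx hy opprD mulNr mulrN.
Qed.

Lemma sg_homot x : sg (homot x) = - homot (sg x).
Proof.
elim/jets_poly_ind: x => [c|f a|x y hx hy|x y hx hy].
- by rewrite homotZ !sgZ homotZ sg1 homot1 sg0 !scaler0 oppr0.
- rewrite sg_jet homotZ homotE (par_homot_var f a).1.
  by case: odd_field; rewrite /= ?expr1 ?expr0 ?scaleN1r ?scale1r ?opprK.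
- by rewrite ?(dqD, homotD, sgD) hx hy opprD.
- by rewrite homotM !sgM homotM sgD !sgM hx hy opprD mulNr mulrN.
Qed.

Lemma sqrCii : 'i * 'i = -1 :> C.
Proof. by rewrite -expr2 sqrCi. Qed.

Lemma linear_grad (L : {linear jets -> jets}) c (F G : idx4 -> field) mu nu a :
  (forall r b, L (jet (F r) b) = c *: jet (G r) b) ->
  L (grad F mu nu a) = c *: grad G mu nu a.
Proof.
move=> h; rewrite /grad linearB linearD /= linearZ_LR linear_sum /= !h.
rewrite scalerBr scalerDr; congr (_ - _).
rewrite scalerA [c * _]mulrC -scalerA; congr (_ *: _).
rewrite scaler_sumr; apply: eq_bigr => r _.
by rewrite linearZ_LR /= h !scalerA mulrC.
Qed.

(** Stated for an arbitrary linear map so as to serve both [dq], with [F = Fu], and [homot], with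
    [F = Fut]. *)
Lemma linear_div_h (L : {linear jets -> jets}) c (F : idx4 -> field) :
  (forall mu nu b, L (jet (Fh mu nu) b) = c *: grad F mu nu b) ->
  forall mu a, L (div_h mu a) = - (c * m ^+ 2) *: jet (F mu) a.
Proof.
move=> h mu a; rewrite linear_sum /= -mulrN -scalerA -div_grad scaler_sumr.
by apply: eq_bigr => r _; rewrite linearZ_LR /= h !scalerA mulrC.
Qed.

(** The only generator with a genuine cancellation is [ut]: by Klein-Gordon the divergence of [h]
    contributes [i m^2 / 2] and the [v] term [- i m^2 / 2]. Products follow since [dq] anticommutes
    with [sg]. *)
Lemma dq_dq x : dq (dq x) = 0.
Proof.
elim/jets_poly_ind: x => [c|f a|x y hx hy|x y hx hy].
- by rewrite !dqZ dq1 dq0 scaler0.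
- case: f => [mu nu|mu|mu|mu].
  + rewrite dq_h dqZ.
    rewrite (@linear_grad dq 0 _ Fu) ?scale0r ?scaler0 // => r b.
    by rewrite scale0r; apply: dq_u.
  + by rewrite dq_v dqZ dq_u scaler0.
  + by rewrite dq_u dq0.
  + rewrite dq_ut dqZ dqD dqZ dq_v.
    rewrite (linear_div_h dq_h) !scalerA -scalerDl.
    suff -> : - (- 'i / 2 * m ^+ 2) + m * (- 'i * m / 2) = 0 :> C.
      by rewrite scale0r scaler0.
    by field.
- by rewrite !dqD hx hy addr0.
- rewrite dqM !dqD !dqM hx hy sgK mul0r mulr0 sg_dq add0r addr0.
  by rewrite mulNr addNr.
Qed.

(** * The weight derivation and its eigenvectors *)

Definition weight x : jets := dq (homot x) + homot (dq x).

Lemma weight_is_linear : linear weight.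
Proof. by move=> c x y; rewrite /weight !linearP /= scalerDr addrACA. Qed.
HB.instance Definition _ :=
  GRing.isLinear.Build C jets jets *:%R weight weight_is_linear.

Lemma weightZ c x : weight (c *: x) = c *: weight x. Proof. exact: linearZ_LR. Qed.
Lemma weightD x y : weight (x + y) = weight x + weight y. Proof. exact: linearD. Qed.
Lemma weight0 : weight 0 = 0. Proof. exact: linear0. Qed.
Lemma weightB x y : weight (x - y) = weight x - weight y. Proof. exact: linearB. Qed.
Lemma dqB x y : dq (x - y) = dq x - dq y. Proof. exact: linearB. Qed.

(** The anticommutator of two odd derivations is an even derivation: the mixed terms cancel because
    [dq] and [homot] both anticommute with [sg]. *)
Lemma weightM x y : weight (x * y) = weight x * y + x * weight y.
Proof.
rewrite /weight homotM dqM dqD homotD !dqM !homotM sg_dq sg_homot !sgK !mulNr.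
rewrite mulrDl mulrDr.
rewrite addrACA [X in X + _]addrACA [X in _ + X]addrACA -[LHS]addrA.
by rewrite -opprD [X in - X]addrC addKr.
Qed.

Lemma weight1 : weight 1 = 0.
Proof. by rewrite /weight homot1 dq1 ?(dq0, homot0) addr0. Qed.

Hypothesis m0 : m != 0.

Lemma weight_u mu a : weight (jet (Fu mu) a) = jet (Fu mu) a.
Proof.
rewrite /weight dq_u homot0 addr0 homot_u dqZ dq_v scalerA.
rewrite -[RHS]scale1r; congr (_ *: _).
have -> : 2 * 'i / m * (- 'i * m / 2) = - ('i * 'i) :> C by field; rewrite m0.
by rewrite sqrCii opprK.
Qed.

Lemma weight_v mu a : weight (jet (Fv mu) a) = jet (Fv mu) a.
Proof.
rewrite /weight homot_v dq0 add0r dq_v homotZ homot_u scalerA.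
rewrite -[RHS]scale1r; congr (_ *: _).
have -> : - 'i * m / 2 * (2 * 'i / m) = - ('i * 'i) :> C by field; rewrite m0.
by rewrite sqrCii opprK.
Qed.

Lemma weight_ut mu a : weight (jet (Fut mu) a) = jet (Fut mu) a.
Proof.
rewrite /weight homot_ut dq0 add0r dq_ut homotZ homotD homotZ homot_v.
rewrite scaler0 addr0 (linear_div_h homot_h) scalerA -[RHS]scale1r; congr (_ *: _).
have -> : 'i * - ('i / m ^+ 2 * m ^+ 2) = - ('i * 'i) :> C by field; rewrite m0.
by rewrite sqrCii opprK.
Qed.

Lemma weight_grad F mu nu a : (forall r b, weight (jet (F r) b) = jet (F r) b) ->
  weight (grad F mu nu a) = grad F mu nu a.
Proof.
move=> h; rewrite (@linear_grad weight 1 F F) ?scale1r // => r b.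
by rewrite scale1r; apply: h.
Qed.

Lemma dq_weight x : dq (weight x) = weight (dq x).
Proof. by rewrite /weight dqD !dq_dq homot0 add0r addr0. Qed.

Definition hinv mu nu a : jets := jet (Fh mu nu) a - weight (jet (Fh mu nu) a).

Lemma homot_dq_h mu nu a :
  homot (dq (jet (Fh mu nu) a)) = m^-1 *: grad Fv mu nu a.
Proof.
rewrite dq_h homotZ (linear_grad _ _ _ homot_u) scalerA; congr (_ *: _).
have -> : - 'i / 2 * (2 * 'i / m) = - ('i * 'i) / m :> C by field; rewrite m0.
by rewrite sqrCii opprK mul1r.
Qed.

(** [weight] commutes with [dq] and fixes [dq h], which is linear in the jets of [u]. *)
Lemma dq_hinv mu nu a : dq (hinv mu nu a) = 0.
Proof.
rewrite /hinv dqB dq_weight dq_h weightZ (weight_grad _ _ _ weight_u); exact: subrr.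
Qed.

(** [weight h] is linear in the jets of [v] plus [dq] of a combination of jets of [ut]; both are
    fixed by [weight], which is thus idempotent on [h]. *)
Lemma weight_hinv mu nu a : weight (hinv mu nu a) = 0.
Proof.
rewrite /hinv weightB {3}/weight weightD -dq_weight homot_dq_h homot_h.
rewrite !weightZ (weight_grad _ _ _ weight_v) (weight_grad _ _ _ weight_ut).
by rewrite /weight homot_dq_h homot_h subrr.
Qed.

(** The jet [d^a phi_{mu nu}]; see [cl_phiT] and [Dj_Phi]. *)
Definition Phi mu nu a : jets := grad Fv mu nu a - m *: jet (Fh mu nu) a.

Lemma hinvE mu nu a :
  hinv mu nu a = - m^-1 *: Phi mu nu a + dq (- homot (jet (Fh mu nu) a)).
Proof.
rewrite /hinv /weight homot_dq_h /Phi; move: (grad _ _ _ _) => g.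
rewrite ?scaleNr scalerBr opprB scalerA mulVf // scale1r.
by rewrite (linearN dq) opprD addrA addrAC.
Qed.

(** * Eigenvector decomposition and reduction to eigenvalue zero *)

Section Decomposition.
Variable G : Expr C -> Prop.

Definition rep_in x := exists q w, gen_alg G q /\ x = cl q + dq w.

Lemma rep_inD x y : rep_in x -> rep_in y -> rep_in (x + y).
Proof.
move=> [q [w [hq ->]]] [q' [w' [hq' ->]]]; exists (Add q q'), (w + w').
by split; [exact: ga_add | rewrite clD dqD addrACA].
Qed.

Lemma rep_inZ c x : rep_in x -> rep_in (c *: x).
Proof.
move=> [q [w [hq ->]]]; exists (Scal c q), (c *: w).
by split; [apply: ga_mul => //; apply: ga_const
          | rewrite clZ dqZ scalerDr].
Qed.

Lemma rep_in_dq w : rep_in (dq w).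
Proof. by exists (Const 0), w; split; [exact: ga_const | rewrite cl0 add0r]. Qed.

Lemma rep_in0 : rep_in 0.
Proof. by rewrite -dq0; apply: rep_in_dq. Qed.

(** Here [q = x - dq w] is closed, so [x y - q q' = q (dq w') + (dq w) y] is exact. The outer [sg]
    in the witness cancels the Leibniz sign. *)
Lemma rep_inM x y : dq x = 0 -> dq y = 0 -> rep_in x -> rep_in y ->
  rep_in (x * y).
Proof.
move=> hx hy [q [w [hq ex]]] [q' [w' [hq' ey]]].
exists (Mul q q'), (sg (cl q) * w' + w * y); split; first exact: ga_mul.
have dq_q : dq (cl q) = 0.
  by move: hx; rewrite ex dqD dq_dq addr0.
rewrite dqD !dqM hy mulr0 addr0 sgK.
have -> : dq (sg (cl q)) = 0 by rewrite -[LHS]opprK -sg_dq dq_q sg0 oppr0.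
by rewrite mul0r add0r clM addrA -mulrDr -ey ex mulrDl.
Qed.

(** Closedness is carried along because [rep_inM] requires it of both factors. *)
Definition harmonic x := [/\ dq x = 0, weight x = 0 & rep_in x].

Lemma harmonicM x y : harmonic x -> harmonic y -> harmonic (x * y).
Proof.
move=> [dx nx rx] [dy ny ry]; split; last exact: rep_inM.
- by rewrite dqM dx dy mul0r mulr0 addr0.
- by rewrite weightM nx ny mul0r mulr0 addr0.
Qed.

Lemma harmonicD x y : harmonic x -> harmonic y -> harmonic (x + y).
Proof.
move=> [dx nx rx] [dy ny ry]; split; last exact: rep_inD.
- by rewrite ?(dqD, weightD) dx dy addr0.
- by rewrite weightD nx ny addr0.
Qed.

Hypothesis rep_in_Phi : forall mu nu a, rep_in (Phi mu nu a).

Lemma harmonic_hinv mu nu a : harmonic (hinv mu nu a).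
Proof.
split; [exact: dq_hinv | exact: weight_hinv |].
by rewrite hinvE; apply: rep_inD; [exact: rep_inZ | exact: rep_in_dq].
Qed.

(** The pair [(k, y)] records the eigenvalue [k + 1]; the offset guarantees that it can be divided
    by. *)
Definition eigen (ky : nat * jets) : bool :=
  `[< weight ky.2 = (ky.1.+1)%:R *: ky.2 >].

Definition decomposable x := exists e0 s,
  [/\ harmonic e0, all eigen s & x = e0 + \sum_(ky <- s) ky.2].

Lemma decomposable_eigen k y : weight y = (k.+1)%:R *: y -> decomposable y.
Proof.
move=> h; exists 0, [:: (k, y)]; split.
- by split; rewrite ?dq0 ?weight0 //; apply: rep_in0.
- by rewrite /= andbT; apply/asboolP.
- by rewrite big_seq1 add0r.
Qed.

Lemma decomposable_harmonic x : harmonic x -> decomposable x.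
Proof. by move=> h; exists x, [::]; split; rewrite ?big_nil ?addr0. Qed.

Lemma decomposableD x y :
  decomposable x -> decomposable y -> decomposable (x + y).
Proof.
move=> [e0 [s [h0 hs ->]]] [f0 [t [k0 ht ->]]]; exists (e0 + f0), (s ++ t).
split; first exact: harmonicD.
- by rewrite all_cat hs.
- by rewrite big_cat addrACA.
Qed.

Lemma decomposableM x y :
  decomposable x -> decomposable y -> decomposable (x * y).
Proof.
move=> [e0 [s [h0 /allP hs ->]]] [f0 [t [k0 /allP ht ->]]].
(* Eigenvalues add under products; with the offset, [(k + 1) + (l + 1)] is recorded as
   [(k + l).+1]. *)
exists (e0 * f0), ([seq (ky.1, e0 * ky.2) | ky <- t] ++
  ([seq (ky.1, ky.2 * f0) | ky <- s] ++
   [seq ((kx.1 + ky.1).+1, kx.2 * ky.2) | kx <- s, ky <- t])).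
split; first exact: harmonicM.
- have [_ n0 _] := h0; have [_ n1 _] := k0.
  rewrite !all_cat !all_map; apply/and3P; split; apply/allP.
  + move=> ky /ht /asboolP h; apply/asboolP.
    by rewrite /= weightM n0 mul0r add0r h scalej_mulr.
  + move=> ky /hs /asboolP h; apply/asboolP.
    by rewrite /= weightM n1 mulr0 addr0 h scalej_mull.
  + move=> _ /allpairsP[[kx ky] /= [/hs /asboolP hx /ht /asboolP hy ->]].
    apply/asboolP; rewrite /= weightM hx hy scalej_mull scalej_mulr -scalerDl.
    by rewrite -natrD addnS addSn.
- rewrite !big_cat !big_map big_allpairs_dep /= mulrDl !mulrDr -!addrA.
  congr (_ + _); rewrite -mulr_sumr -mulr_suml; congr (_ + (_ + _)).
  by rewrite big_distrlr.
Qed.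

Lemma all_decomposable x : decomposable x.
Proof.
elim/jets_poly_ind: x => [c|f a||]; last 2 first.
- exact: decomposableD.
- exact: decomposableM.
- apply: decomposable_harmonic; split.
  + by rewrite dqZ dq1 scaler0.
  + by rewrite weightZ weight1 scaler0.
  + exists (Const c), 0; rewrite clC dq0 addr0; split=> //; exact: ga_const.
- case: f => [mu nu|mu|mu|mu].
  (* Split [h] into [hinv], of eigenvalue 0, and [weight h], of eigenvalue 1. *)
  + rewrite -[jet _ _](subrK (weight (jet (Fh mu nu) a))); apply: decomposableD.
      exact/decomposable_harmonic/harmonic_hinv.
    apply: (@decomposable_eigen 0); rewrite scale1r.
    by have /eqP := weight_hinv mu nu a; rewrite weightB subr_eq0 => /eqP.
  + by apply: (@decomposable_eigen 0); rewrite scale1r weight_v.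
  + by apply: (@decomposable_eigen 0); rewrite scale1r weight_u.
  + by apply: (@decomposable_eigen 0); rewrite scale1r weight_ut.
Qed.

(* x is cohomologous to x - weight x / k, which has one eigenvalue fewer. *)
Lemma closed_rep_in x : dq x = 0 -> rep_in x.
Proof.
have [e0 [s [h0 hs ex]]] := all_decomposable x.
have [n] := ubnP (size s); elim: n => // n IHn in s x hs ex *.
case: s hs ex => [|[k y] s] /=; first by rewrite big_nil addr0 => _ -> _ _; case: h0.
move=> /andP[/asboolP /= hy hs]; rewrite big_cons /= ltnS => ex le_s dx.
pose c : C := (k.+1)%:R^-1.
(* As [x] is closed, [weight x] equals [dq (homot x)]. *)
have -> : x = (x - c *: weight x) + dq (c *: homot x).
  by rewrite dqZ {1}/weight dx homot0 addr0 subrK.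
apply: rep_inD; last exact: rep_in_dq.
(* Subtracting [c *: weight x] removes [y], leaves [e0] unchanged and rescales every other
   eigenvector. *)
apply: (IHn [seq (ky.1, (1 - c * (ky.1.+1)%:R) *: ky.2) | ky <- s]).
- rewrite all_map; apply/allP => ky /(allP hs) /asboolP h; apply/asboolP.
  by rewrite /= weightZ h !scalerA mulrC.
- have [_ n0 _] := h0.
  rewrite ex !weightD n0 add0r hy linear_sum scalerDr scalerA mulVf ?pnatr_eq0 //.
  rewrite scale1r -addrA; congr (_ + _); rewrite opprD addrACA subrr add0r.
  rewrite big_map scaler_sumr -sumrB; apply: eq_big_seq => ky.
  by move=> /(allP hs)/asboolP /= ->; rewrite scalerA scalerBl scale1r.
- by rewrite size_map.
- by rewrite dqB dqZ dq_weight dx weight0 scaler0 subrr.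
Qed.

End Decomposition.

(** * Jets of phi modulo exact terms *)

Lemma KGsol_Phi mu nu : KGsol (Phi mu nu).
Proof.
move=> a; have h := KGsolD (KGsol_grad Fv mu nu) (KGsolZ (- m) (KGsol_jet (Fh mu nu))).
by rewrite /Phi -scaleNr -(h a); apply: eq_bigr => r _; rewrite scaleNr.
Qed.

Lemma PhiC mu nu a : Phi mu nu a = Phi nu mu a.
Proof. by rewrite /Phi gradC jet_hsym. Qed.

Definition trPhi a : jets := \sum_r e r *: Phi r r a.

Lemma KGsol_trPhi : KGsol trPhi.
Proof. exact: KGsol_sum (fun s => KGsolZ _ (KGsol_Phi _ _)). Qed.

(** By [div_grad] the left side is [- m^2 v_mu - m d^nu h_{mu nu}], which is [m i] times
    [dq ut_mu]. *)
Lemma div_Phi mu a :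
  \sum_r e r *: Phi mu r (mshift a r) = dq ((m * 'i) *: jet (Fut mu) a).
Proof.
rewrite /Phi; under eq_bigr do rewrite scalerBr.
rewrite sumrB div_grad dqZ dq_ut scalerA -mulrA sqrCii mulrN1 scalerDr.
rewrite !scaleNr [m *: (m *: _)]scalerA -expr2 [RHS]addrC; congr (_ - _).
rewrite scaler_sumr; apply: eq_bigr => r _.
by rewrite !scalerA mulrC.
Qed.

Lemma Dj_grad F r mu nu a : Dj r (grad F mu nu a) = grad F mu nu (mshift a r).
Proof.
rewrite /grad linearB linearD /= linearZ_LR linear_sum /= !Dj_jet.
rewrite !(mshiftC _ r); congr (_ - _ *: _); apply: eq_bigr => s _.
by rewrite linearZ_LR /= Dj_jet mshiftC.
Qed.

Lemma Dj_Phi r mu nu a : Dj r (Phi mu nu a) = Phi mu nu (mshift a r).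
Proof. by rewrite /Phi linearB /= linearZ_LR /= Dj_grad Dj_jet. Qed.

Lemma Dj_trPhi r a : Dj r (trPhi a) = trPhi (mshift a r).
Proof.
rewrite /trPhi linear_sum; apply: eq_bigr => s _.
by rewrite /= linearZ_LR /= Dj_Phi.
Qed.

Lemma cl_phiT mu nu : cl (phiT m mu nu) = Phi mu nu mi0.
Proof.
rewrite !clB clD clZ clZ cl_esum; congr (_ - _ *: _ - _).
by apply: eq_bigr => r _; rewrite clZ.
Qed.

Lemma cl_phitr : cl (phitr m) = trPhi mi0.
Proof. by rewrite cl_esum; apply: eq_bigr => r _; rewrite clZ cl_phiT. Qed.

Definition mi_seq (s : seq idx4) : mindex := foldr (fun r a => mshift a r) mi0 s.

Lemma cl_Dlist s x : cl (Dlist s x) = foldr Dj (cl x) s.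
Proof. by elim: s => //= r s <-; rewrite DjE. Qed.

(** The first [c] slots are tensor indices (two for [phi_{mu nu}], none for its trace); the other
    [n] are derivatives, collected into a multi-index. *)
Definition mi_of c n (idx : 'I_(c + n) -> idx4) : mindex :=
  mi_seq [seq ix idx (c + j) | j <- iota 0 n].

Lemma cl_Pten n (idx : 'I_(2 + n) -> idx4) :
  cl (Pten m idx) = Phi (ix idx 0) (ix idx 1) (mi_of idx).
Proof.
rewrite cl_Dlist cl_phiT /mi_of; elim: [seq _ | _ <- _] => //= r s ->.
exact: Dj_Phi.
Qed.

Lemma cl_Pstr n (idx : 'I_(0 + n) -> idx4) : cl (Pstr m idx) = trPhi (mi_of idx).
Proof.
rewrite cl_Dlist cl_phitr /mi_of; elim: [seq _ | _ <- _] => //= r s ->.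
exact: Dj_trPhi.
Qed.

(** * Multi-indices and contractions of derivative slots *)

Definition mdeg (a : mindex) := (\sum_j a j)%N.

Lemma mdeg_mshift a r : mdeg (mshift a r) = (mdeg a).+1.
Proof.
rewrite /mdeg; under eq_bigr do rewrite ffunE.
rewrite big_split /= -[RHS]addn1; congr addn.
by rewrite (bigD1 r) //= eqxx big1 // => i /negbTE ->.
Qed.

Lemma mdeg_mi_seq s : mdeg (mi_seq s) = size s.
Proof.
elim: s => [|r s IHs] /=; last by rewrite mdeg_mshift IHs.
by apply: big1 => j _; rewrite ffunE.
Qed.

Lemma mi_seq_surj a : exists s, a = mi_seq s.
Proof.
have [n] := ubnP (mdeg a); elim: n => // n IHn in a *; rewrite ltnS => le_a.
have [/forallP a0|] := boolP [forall j, a j == 0%N].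
  by exists [::]; apply/ffunP => j; rewrite ffunE; apply/eqP.
rewrite negb_forall => /existsP[r ar].
pose b : mindex := [ffun j => (a j - (j == r))%N].
have eb : a = mshift b r.
  apply/ffunP => j; rewrite !ffunE subnK //; case: eqP => // ->.
  by rewrite lt0n.
have [|s es] := IHn b; first by rewrite -(mdeg_mshift b r) -eb.
by exists (r :: s); rewrite /= -es.
Qed.

Lemma ixE k (idx : 'I_k -> idx4) (p : 'I_k) : ix idx p = idx p.
Proof. by rewrite /ix valK. Qed.

Lemma mi_seqE s j : mi_seq s j = count_mem j s.
Proof. by elim: s => [|r s IHs] /=; rewrite ffunE // IHs addnC eq_sym. Qed.

(** Counting occurrences removes the order of the derivatives and exposes the effect of changing
    single slots by [set2]. *)
Lemma mi_ofE c n (idx : 'I_(c + n) -> idx4) j :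
  mi_of idx j = (\sum_(p < c + n | c <= p) (idx p == j))%N.
Proof.
rewrite mi_seqE count_map -sum1_count big_mkcond /=.
have -> : iota 0 n = index_iota 0 n by rewrite /index_iota subn0.
rewrite [RHS]big_mkcond big_split_ord /= [X in _ = (X + _)%N]big1 ?add0n; last first.
  by move=> p _; rewrite leqNgt ltn_ord.
rewrite big_mkord; apply: eq_bigr => p _.
by rewrite leq_addr -[(c + p)%N]/(val (rshift c p)) ixE; case: eqP.
Qed.

Lemma mi_of_surj c n (t : seq idx4) a : size t = c -> mdeg a = n ->
  exists idx : 'I_(c + n) -> idx4, mi_of idx = a /\
    forall i, (i < c)%N -> ix idx i = nth ord0 t i.
Proof.
move=> st; have [s ->] := mi_seq_surj a; rewrite mdeg_mi_seq => sn.
exists (fun p => nth ord0 (t ++ s) p).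
have E i : (i < c + n)%N ->
  ix (fun p : 'I_(c + n) => nth ord0 (t ++ s) p) i = nth ord0 (t ++ s) i.
  by move=> hi; rewrite -[i]/(val (Ordinal hi)) ixE.
split=> [|i ic]; last by rewrite E ?ltn_addr // nth_cat st ic.
congr mi_seq; apply: (@eq_from_nth _ ord0) => [|i]; rewrite size_map size_iota //.
move=> hi; rewrite (nth_map 0%N) ?size_iota // nth_iota // add0n E ?ltn_add2l //.
by rewrite nth_cat st ltnNge leq_addr /= addKn.
Qed.

Section MultiIndexTraces.
Variables (c n : nat) (idx : 'I_(c + n) -> idx4) (a b : 'I_(c + n)).
Hypothesis ab : (a < b)%N.

(** Contracting two derivatives produces a wave operator; the degree of [d] feeds the induction on
    the number of derivatives. *)
Lemma mi_of_set2_two : (c <= a)%N -> exists d, (mdeg d).+2 = n /\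
  forall r, mi_of (set2 idx a b r r) = mshift (mshift d r) r.
Proof.
move=> ca; have cb : (c <= b)%N by apply: leq_trans ca (ltnW ab).
have ba : b != a by rewrite -val_eqE gtn_eqF.
pose d : mindex := [ffun j =>
  (\sum_(p < c + n | [&& c <= p, p != a & p != b]) (idx p == j))%N].
have hd r : mi_of (set2 idx a b r r) = mshift (mshift d r) r.
  apply/ffunP => j; rewrite mi_ofE !ffunE (bigD1 a) //=.
  rewrite (bigD1 b) /=; last by rewrite cb.
  rewrite /set2 eqxx (negbTE ba) eqxx eq_sym addnA addnC -addnA; congr addn.
  by apply: eq_big => p; rewrite ?andbA // => /andP[/andP[_ /negbTE -> /negbTE ->]].
(* The degree is read off from [hd] at an arbitrary value of [r], here [ord0]. *)
exists d; split=> //; rewrite -(mdeg_mshift d ord0) -(mdeg_mshift _ ord0) -hd.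
by rewrite /mi_of mdeg_mi_seq size_map size_iota.
Qed.

(** Contracting a tensor index with a derivative produces a divergence. *)
Lemma mi_of_set2_one : (a < c)%N -> (c <= b)%N -> exists d,
  forall r, mi_of (set2 idx a b r r) = mshift d r.
Proof.
move=> ac cb; have ba : b != a by rewrite -val_eqE gtn_eqF.
exists [ffun j => (\sum_(p < c + n | (c <= p) && (p != b)) (idx p == j))%N] => r.
apply/ffunP => j; rewrite mi_ofE !ffunE (bigD1 b) //=.
rewrite /set2 eqxx (negbTE ba) eq_sym addnC; congr addn.
apply: eq_bigr => p /andP[cp /negbTE ->]; case: (p =P a) => // pa.
by move: cp; rewrite pa leqNgt ac.
Qed.

Lemma mi_of_set2_none r s : (b < c)%N -> mi_of (set2 idx a b r s) = mi_of idx.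
Proof.
move=> bc; apply/ffunP => j; rewrite !mi_ofE; apply: eq_bigr => p cp.
rewrite /set2; case: (p =P a) => [pa|_]; last case: (p =P b) => [pb|//].
- by move: cp; rewrite pa leqNgt (ltn_trans ab bc).
- by move: cp; rewrite pb leqNgt bc.
Qed.

End MultiIndexTraces.

(** * Induction on the number of derivatives *)

Section Span.
Variable G : Expr C -> Prop.
Let L := rep_in G.

(** The last clause of [traceless_exists], for the subspace of elements represented modulo exact
    terms. *)
Definition trace_stable k (T S : ('I_k -> idx4) -> jets) : Prop :=
  (forall a b : 'I_k, (a < b)%N -> forall idx,
     L (\sum_r e r *: T (set2 idx a b r r))) -> forall idx, L (T idx - S idx).

Variables (SP : forall n, ('I_(2 + n) -> idx4) -> jets)
          (SS : forall n, ('I_n -> idx4) -> jets).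
Hypothesis SP_in : forall n idx, L (@SP n idx).
Hypothesis SS_in : forall n idx, L (@SS n idx).
Hypothesis SP_stable : forall n, trace_stable (fun idx => cl (@Pten C m n idx)) (@SP n).
Hypothesis SS_stable : forall n, trace_stable (fun idx => cl (@Pstr C m n idx)) (@SS n).

(** Every trace contracts two derivatives, so by Klein-Gordon it is [- m^2] times a jet of degree
    lower by two. *)
Lemma rep_in_trPhi a : L (trPhi a).
Proof.
have [n] := ubnP (mdeg a); elim: n => // n IHn in a *; rewrite ltnS => le_a.
have [idx [ha _]] := @mi_of_surj 0 (mdeg a) [::] a erefl erefl.
rewrite -ha -cl_Pstr -[cl _](subrK (@SS _ idx)); apply: rep_inD; last exact: SS_in.
apply: SS_stable => {idx ha} p q pq idx.
have [d [hd h]] := mi_of_set2_two idx pq (leq0n _).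
under eq_bigr do rewrite cl_Pstr h.
rewrite KGsol_trPhi; apply/rep_inZ/IHn.
by apply: leq_trans le_a; rewrite -hd.
Qed.

Lemma rep_in_Phi_of_traceless mu nu a : L (Phi mu nu a).
Proof.
have [n] := ubnP (mdeg a); elim: n => // n IHn in mu nu a *; rewrite ltnS => le_a.
have [idx [ha hi]] := @mi_of_surj 2 (mdeg a) [:: mu; nu] a erefl erefl.
rewrite -{1}ha -[mu]/(nth ord0 [:: mu; nu] 0) -[X in Phi _ X]/(nth ord0 [:: mu; nu] 1).
rewrite -!hi // -cl_Pten -[cl _](subrK (@SP _ idx)).
apply: rep_inD; last exact: SP_in.
apply: SP_stable => {idx ha hi} p q pq idx.
(* The value of tensor slot [i] once the slots [p] and [q] are set to [r]. *)
pose index i r := if i == p :> nat then r else if i == q :> nat then r else ix idx i.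
have ix_set2 i r : (i < 2)%N -> ix (set2 idx p q r r) i = index i r.
  move=> i2; have hi : (i < 2 + mdeg a)%N by apply: ltn_addr.
  by rewrite /index -[i]/(val (Ordinal hi)) !ixE.
under eq_bigr do rewrite cl_Pten !ix_set2 //.
(* Both contracted slots are derivatives: Klein-Gordon and the induction hypothesis apply. *)
have [p2|p2] := leqP 2 p.
  have [d [hd h]] := mi_of_set2_two idx pq p2.
  have lt_eqF (i : nat) (r : 'I_(2 + mdeg a)) :
      (i < 2)%N -> (2 <= r)%N -> (i == r) = false.
    by move=> i2 r2; rewrite ltn_eqF // (leq_trans i2).
  have q2 : (2 <= q)%N := ltnW (leq_ltn_trans p2 pq).
  under eq_bigr do rewrite h /index !lt_eqF //.
  rewrite KGsol_Phi; apply/rep_inZ/IHn.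
  by apply: leq_trans le_a; rewrite -hd.
(* One tensor index meets one derivative: the divergence is exact, after exchanging the tensor
   indices if the first one is contracted. *)
have [q2|q2] := leqP 2 q.
  have [d h] := mi_of_set2_one idx pq p2 q2.
  have /orP[/eqP p0|/eqP p1] : (p == 0 :> nat) || (p == 1 :> nat).
  - by case: (nat_of_ord p) p2 => [|[]].
  - under eq_bigr do rewrite h /index p0 /= ltn_eqF ?(leq_trans _ q2) // PhiC.
    by rewrite div_Phi; apply: rep_in_dq.
  - under eq_bigr do rewrite h /index p1 /= !ltn_eqF ?(leq_trans _ q2) //.
    by rewrite div_Phi; apply: rep_in_dq.
(* Both tensor indices are contracted, which leaves a jet of the scalar [phi]. *)
have q1 : q = 1 :> nat by move: pq q2; case: (nat_of_ord q) => [|[]].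
have p0 : p = 0 :> nat by move: pq; rewrite q1; case: (nat_of_ord p).
under eq_bigr do rewrite mi_of_set2_none // /index p0 q1 /=.
apply: rep_in_trPhi.
Qed.

End Span.

End JetAlgebra.

(** * Traceless parts of tensors of expressions *)

Section TracelessParts.
Variables (C : numClosedFieldType) (m : C) (k : nat) (T : ('I_k -> 'I_4) -> Expr C).

Let tl := cid (traceless_exists (fun idx => cl m (T idx))).
Definition tl_jets : ('I_k -> 'I_4) -> jets m := projT1 tl.
Definition tl_part (idx : 'I_k -> 'I_4) : Expr C := rep (tl_jets idx).

Lemma tl_partP : traceless_part m T tl_part.
Proof.
have [h1 [U h2] _] := projT2 tl; split.
- move=> a b ab idx; apply/(clP m); rewrite cl_esum -[RHS](h1 a b ab idx).
  by apply: eq_bigr => r _; rewrite clZ repK.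
- exists (fun a b idx => rep (U a b idx)) => idx; apply/(clP m).
  rewrite clB repK h2 cl_foldr; apply: eq_bigr => ab _.
  by rewrite clZ repK.
Qed.

Lemma tl_part_stable G : trace_stable G (fun idx => cl m (T idx)) tl_jets.
Proof.
have [_ _ h] := projT2 tl; apply: h.
- exact: rep_in0.
- exact: rep_inD.
- exact: rep_inZ.
Qed.

End TracelessParts.

Theorem mainTheorem6 (C : numClosedFieldType) (m : C) (hm : 0 < m) (p : Expr C) :
  peq m (dQ m p) (Const 0) ->
  exists (SR : forall n : nat, ('I_(4 + n) -> 'I_4) -> Expr C)
         (SP : forall n : nat, ('I_(2 + n) -> 'I_4) -> Expr C)
         (SS : forall n : nat, ('I_n -> 'I_4) -> Expr C),
    (forall n, traceless_part m (@Rten C n) (SR n)) /\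
    (forall n, traceless_part m (@Pten C m n) (SP n)) /\
    (forall n, traceless_part m (@Pstr C m n) (SS n)) /\
    exists b q : Expr C,
      gen_alg (fun e => (exists n idx, e = SR n idx) \/
                        (exists n idx, e = SP n idx) \/
                        (exists n idx, e = SS n idx)) q /\
      peq m p (Add q (dQ m b)).
Proof.
move=> dp; have m0 : m != 0 by rewrite gt_eqF.
exists (fun n => tl_part m (@Rten C n)), (fun n => tl_part m (@Pten C m n)),
  (fun n => tl_part m (@Pstr C m n)).
do 3![split; first by move=> n; apply: tl_partP].
set G := (G in gen_alg G).
have rep_in_tl k (T : ('I_k -> 'I_4) -> Expr C) idx :
    G (tl_part m T idx) -> rep_in G (tl_jets m T idx).
  move=> h; exists (tl_part m T idx), 0; split; first exact: ga_gen.
  by rewrite repK dq0 addr0.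
have [||x [w [hx ex]]] := @closed_rep_in C m m0 G _ (cl m p).
(* The chosen traceless parts are generators and are stable under traces, so all jets of
   [phi_{mu nu}] are represented. *)
- apply: (@rep_in_Phi_of_traceless C m G (fun n => tl_jets m (@Pten C m n))
    (fun n => tl_jets m (@Pstr C m n))).
  + by move=> n idx; apply: rep_in_tl; right; left; exists n, idx.
  + by move=> n idx; apply: rep_in_tl; right; right; exists n, idx.
  + by move=> n; apply: tl_part_stable.
  + by move=> n; apply: tl_part_stable.
- by rewrite dqE; apply/clP.
exists (rep w), x; split=> //; apply/(clP m).
by rewrite clD ex -dqE repK.
Qed.
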